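(* Any polynomial-size data structure for maintaining a longest common substring of two dynamic strings (both undergoing single-letter substitutions), each of length at most $n$, requires $\Omega(\log n/\log\log n)$ time per update operation.
   Context: A longest common substring of two strings is a longest string occurring as a substring of both. The lower bound is for data structures in the cell-probe/word-RAM model with words of $\Theta(\log n)$ bits. *)

(* Defs.v *)
From Stdlib Require Import Reals Lia List Arith.
Import ListNotations.
Set Implicit Arguments.

Definition str := list nat.

Definition substr (s : str) (i l : nat) : str := firstn l (skipn i s).

Definition common_at (S T : str) (i j l : nat) : Prop :=
  i + l <= length S /\ j + l <= length T /\ substr S i l = substr T j l.

Definition is_lcs (S T : str) (a : nat * nat * nat) : Prop :=
  let '(i, j, l) := a in
  common_at S T i j l /\
  forall i' j' l', common_at S T i' j' l' -> l' <= l.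

Definition subst_letter (s : str) (i c : nat) : str :=
  firstn i s ++ c :: skipn (S i) s.

Definition memory := nat -> nat.

Definition mem_upd (m : memory) (a v : nat) : memory :=
  fun x => if Nat.eqb x a then v else m x.

(* An (adaptive) cell-probe algorithm returning a value of type A:
   it may read a cell and continue depending on its content, write a
   cell, or stop with an answer. Computation is free; the cost is the
   number of cell probes (reads and writes). *)
Inductive prog (A : Type) : Type :=
| Ret : A -> prog A
| Rd  : nat -> (nat -> prog A) -> prog A
| Wr  : nat -> nat -> prog A -> prog A.

Arguments Ret {A} _.
Arguments Rd {A} _ _.
Arguments Wr {A} _ _ _.

Fixpoint run {A : Type} (sp w : nat) (m : memory) (p : prog A)
  : option (memory * A * nat) :=
  match p with
  | Ret a => Some (m, a, 0)
  | Rd x k =>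
      if Nat.ltb x sp then
        match run sp w m (k (m x)) with
        | Some (m', a, c) => Some (m', a, S c)
        | None => None
        end
      else None
  | Wr x v p' =>
      if andb (Nat.ltb x sp) (Nat.ltb v (2 ^ w)) then
        match run sp w (mem_upd m x v) p' with
        | Some (m', a, c) => Some (m', a, S c)
        | None => None
        end
      else None
  end.

(* An update (j, i, c) substitutes letter c at position i of the first
   string (j = false) or of the second string (j = true). Each update
   algorithm, after performing the update, reports a longest common
   substring (i, j, l) of the two current strings. *)
Record lcs_ds : Type := {
  ds_init : str -> str -> memory;                      (* free preprocessing *)
  ds_upd  : bool -> nat -> nat -> prog (nat * nat * nat)
}.

Definition letters_lt (sigma : nat) (s : str) : Prop :=
  forall x, In x s -> x < sigma.

Definition valid_op (sigma : nat) (S T : str) (op : bool * nat * nat) : Prop :=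
  let '(j, i, c) := op in
  i < length (if j then T else S) /\ c < sigma.

Fixpoint behaves (D : lcs_ds) (sigma sp w t : nat) (m : memory) (S T : str)
  (ops : list (bool * nat * nat)) : Prop :=
  match ops with
  | [] => True
  | (j, i, c) :: ops' =>
      valid_op sigma S T (j, i, c) ->
      let S' := if j then S else subst_letter S i c in
      let T' := if j then subst_letter T i c else T in
      match run sp w m (ds_upd D j i c) with
      | None => False
      | Some (m', a, cost) =>
          cost <= t /\ is_lcs S' T' a /\ behaves D sigma sp w t m' S' T' ops'
      end
  end.

Definition lcs_ds_correct (D : lcs_ds) (n sigma sp w t : nat) : Prop :=
  forall S T : str,
    length S <= n -> length T <= n ->
    letters_lt sigma S -> letters_lt sigma T ->
    (forall x, x < sp -> ds_init D S T x < 2 ^ w) /\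
    forall ops, behaves D sigma sp w t (ds_init D S T) S T ops.

(* Main.v *)
Require Import Defs.
From Stdlib Require Import Reals Lia Lra List Arith.
From mathcomp Require all_boot all_fingroup order ssralg ssrnum ssrint zify.

(** Marked ancestors hide in longest common substrings. Take a tree of arity [B]
    and depth [R]. The first string has a block for every leaf [X], spelling the
    ancestors of [X]; the second has a block for every vertex, carrying a mark.
    Activating one leaf costs one substitution, after which the longest common
    substring is longer than [R] iff the leaf has a marked ancestor.

    The marks of level [i] are rewritten every [B^(i+1)] time steps, for
    [N = B^(R+1)] steps. A mark of level [i] is then determined by [i+1] digits
    of a leaf and the remaining digits of a time, so that a query (leaf, time)
    is a path in a butterfly graph, and the history is given by a set [D] of
    marked butterfly vertices. Recorded cell by cell, the contents of the memory
    over time form a function with at most [2tRN] breaks, and a query reads it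
    in [t] points.

    A choice of one permutation per butterfly switch yields a batch of [B^R]
    queries passing through [M = R * B^R] vertices. On average over [D], a
    fraction [2^-M] of the batches avoids [D]. As [t <= R/4], there are so few
    sets of [kappa = M/4] constant pieces of the history that one of them
    answers sufficiently many of these batches to make them pass, by AM-GM,
    through at least [M * h] vertices, where [h] is of order [log n]. Those
    pieces can be described in [kappa * O(log n)] bits, yet they force [M * h]
    vertices to be unmarked: there are too few such descriptions to account for
    all [D]. With [B] polylogarithmic, [R] is of order [log n / log log n]. *)

Module MarkedAncestors.

Import all_boot all_fingroup zify.
Set Implicit Arguments.
Unset Strict Implicit.
Unset Printing Implicit Defensive.

(** * Certificates *)

Section Breaks.
Variable F : nat -> nat.

(** The term [j = 0] compares [F 0] with itself, so only changes of value count; [piece k] then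
    numbers the maximal constant run containing [k]. *)
Definition breaks K := \sum_(0 <= j < K) (F j != F j.-1).
Definition piece k := breaks k.+1.

Lemma leq_breaks j k : j <= k -> breaks j <= breaks k.
Proof. by move=> le_jk; rewrite /breaks [leqRHS](big_cat_nat (n := j)) //= leq_addr. Qed.

Lemma leq_piece j k : j <= k -> piece j <= piece k.
Proof. by move=> le_jk; apply: leq_breaks. Qed.

Lemma piece_const j k : j <= k -> piece j = piece k -> F j = F k.
Proof.
elim: k => [|k IHk]; first by rewrite leqn0 => /eqP->.
rewrite leq_eqVlt => /predU1P[-> //|]; rewrite ltnS => le_jk eq_p.
have Ep: piece k.+1 = piece k + (F k.+1 != F k).
  by rewrite /piece /breaks big_nat_recr.
have := leq_piece le_jk; rewrite eq_p Ep -[leqRHS]addn0 leq_add2l leqn0.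
rewrite eqb0 negbK => /eqP EF; rewrite EF; apply: IHk => //.
by rewrite eq_p Ep EF eqxx addn0.
Qed.

Lemma piece_segment K Vn g : (forall k, k < K -> F k < Vn) ->
  exists T : 'I_K.+1 * 'I_K.+1 * 'I_Vn.+1,
    (forall k, k < K -> T.1.1 <= k <= T.1.2 -> F k = T.2) /\
    (forall k, k < K -> piece k = g -> T.1.1 <= k <= T.1.2).
Proof.
move=> ltFV; case: (pickP (fun k : 'I_K => piece k == g)) => [k0 pk0 | none].
  case: (@arg_minnP _ k0 (fun i => piece i == g) (fun i : 'I_K => i : nat) pk0) => lo /eqP p_lo lo_min.
  case: (@arg_maxnP _ k0 (fun i => piece i == g) (fun i : 'I_K => i : nat) pk0) => hi /eqP p_hi hi_max.
  exists (widen_ord (leqnSn K) lo, widen_ord (leqnSn K) hi,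
          widen_ord (leqnSn Vn) (Ordinal (ltFV _ (ltn_ord lo)))).
  split=> /= k ltkK => [/andP[le_lo le_hi] | pk].
    apply/esym/piece_const => //; apply/eqP; rewrite eqn_leq leq_piece //=.
    by rewrite p_lo -p_hi leq_piece.
  move/eqP in pk; apply/andP; split.
    exact: (lo_min (Ordinal ltkK)).
  exact: (hi_max (Ordinal ltkK)).
(* An empty piece gets the bounds [K] and [0], between which no [k < K] lies. *)
exists (ord_max, ord0, ord0); split=> /= k ltkK.
  by rewrite leqNgt ltkK.
by move/eqP=> pk; have := none (Ordinal ltkK); rewrite /= pk.
Qed.

End Breaks.

Lemma card_bigcup_leq (I T : finType) (P : pred I) (X : I -> {set T}) :
  #|\bigcup_(i | P i) X i| <= \sum_(i | P i) #|X i|.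
Proof.
elim/big_rec2: _ => [|i m A _ IH]; first by rewrite cards0.
by rewrite (leq_trans (leq_card_setU _ _).1) // leq_add2l.
Qed.


Lemma card_disjoint_sets (U : finType) (X : {set U}) :
  2 ^ #|X| * #|[set D : {set U} | [disjoint X & D]]| = 2 ^ #|U|.
Proof.
have -> : [set D : {set U} | [disjoint X & D]] = powerset (~: X).
  by apply/setP=> D; rewrite !inE disjoint_sym disjoints_subset.
by rewrite card_powerset -expnD cardsC.
Qed.

Lemma superset_card (T : finType) (A : {set T}) k : #|A| <= k <= #|T| ->
  exists2 C : {set T}, A \subset C & #|C| = k.
Proof.
case/andP=> leAk lekT; exists (A :|: [set x in take (k - #|A|) (enum (~: A))]).
  exact: subsetUl.
rewrite cardsU; have -> : A :&: [set x in take (k - #|A|) (enum (~: A))] = set0.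
  apply/setP=> x; rewrite !inE; apply/negP=> /andP[Ax /mem_take].
  by rewrite mem_enum inE Ax.
rewrite cards0 subn0 cardsE.
rewrite (card_uniqP _) ?take_uniq ?enum_uniq // size_take_min -cardE.
by rewrite (minn_idPl _) ?subnKC // (cardsCs (~: A)) setCK leq_sub2r.
Qed.

(** * Counting mark sets by short certificates *)

Section Certificates.

(** [U] stands for the butterfly vertices, [BT] for the batches, [Q] for the queries; [F D] is the
    history under the mark set [D], read by the query [q] at the points [rd D q]. *)
Variables (U BT Q : finType) (els : Q -> {set U}) (qs : BT -> {set Q}).
Variables (M h kappa K P Vn t : nat).
Variables (F : {set U} -> nat -> nat) (rd : {set U} -> Q -> seq nat).

Definition touched (A : BT) := \bigcup_(q in qs A) els q.

Hypothesis card_touched : forall A, #|touched A| <= M.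
Hypothesis card_qs : forall A, #|qs A| * t <= kappa.
Hypothesis spread : forall V : {set U}, #|V| < M * h ->
  #|[set A | touched A \subset V]| <= h ^ M.
Hypothesis F_lt : forall D k, k < K -> F D k < Vn.
Hypothesis F_breaks : forall D, breaks (F D) K < P.
Hypothesis rd_lt : forall D q k, k \in rd D q -> k < K.
Hypothesis rd_size : forall D q, size (rd D q) <= t.
Hypothesis local : forall D D' q, (forall k, k \in rd D q -> F D k = F D' k) ->
  [disjoint els q & D] -> [disjoint els q & D'].
Hypothesis kappaP : kappa <= P.
Hypothesis many_batches : 2 ^ M.+1 * ('C(P, kappa) * h ^ M) < #|BT|.
Hypothesis few_certs :
  2 ^ M.+1 * (K.+1 * K.+1 * Vn.+1) ^ kappa < 2 ^ (M * h).

(** An entry (lo, hi, value) claims that the history has this value throughout [lo, hi]. *)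
Definition cert := {ffun 'I_kappa -> 'I_K.+1 * 'I_K.+1 * 'I_Vn.+1}.

Definition covers (c : cert) (k : nat) :=
  [exists j, (c j).1.1 <= k <= (c j).1.2].

Definition sat (D : {set U}) (c : cert) :=
  [forall j, forall k : 'I_K,
     ((c j).1.1 <= k <= (c j).1.2) ==> (F D k == (c j).2)].

(* The vertices that the pieces in [c] alone suffice to declare unmarked. *)
Definition exposed (D : {set U}) (c : cert) : {set U} :=
  \bigcup_(q | [disjoint els q & D] && all (covers c) (rd D q)) els q.

(** A query contributing to [exposed D c] reads only covered points, where both histories have the
    values in [c]; [local] carries its answer over to [D']. *)
Lemma exposed_disjoint D D' c :
  sat D c -> sat D' c -> [disjoint exposed D c & D'].
Proof.
move=> satD satD'; rewrite disjoint_sym; apply/bigcup_disjointP=> q.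
case/andP=> dis /allP cov; rewrite disjoint_sym; apply: local dis => k rd_k; have ltkK := rd_lt rd_k.
have /existsP[j le_jk] := cov _ rd_k.
move/forallP/(_ j)/forallP/(_ (Ordinal ltkK)): satD; rewrite le_jk /= => /eqP->.
by move/forallP/(_ j)/forallP/(_ (Ordinal ltkK)): satD'; rewrite le_jk /= => /eqP->.
Qed.

Lemma cert_of_pieces D (C : {set 'I_P}) : #|C| <= kappa ->
  exists2 c, sat D c &
    forall k (g : 'I_P), k < K -> g \in C -> piece (F D) k = g -> covers c k.
Proof.
move=> leC; have [T segT] := fin_all_exists
  (fun g : 'I_P => piece_segment (g : nat) (@F_lt D)).
pose vac : 'I_K.+1 * 'I_K.+1 * 'I_Vn.+1 := (ord_max, ord0, ord0).
exists [ffun j : 'I_kappa => nth vac (map T (enum C)) j].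
  apply/forallP=> j; apply/forallP=> k; apply/implyP; rewrite ffunE.
  have [lt_j | le_j] := ltnP j (size (map T (enum C))); last first.
    by rewrite nth_default //= leqNgt ltn_ord.
  have /mapP[g _ ->] := mem_nth vac lt_j.
  by move=> le_k; apply/eqP; have [->] := segT g.
move=> k g ltkK Cg pk; have lt_i: index g (enum C) < kappa.
  by rewrite (leq_trans _ leC) // cardE index_mem mem_enum.
apply/existsP; exists (Ordinal lt_i); rewrite ffunE /=.
rewrite (nth_map g) ?index_mem ?mem_enum // nth_index ?mem_enum //.
by have [_ ->] := segT g.
Qed.

Definition batches (D : {set U}) := [set A | [disjoint touched A & D]].

Definition pieces_read D A : {set 'I_P} :=
  [set g : 'I_P | [exists q in qs A, has (fun k => piece (F D) k == g) (rd D q)]].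

Lemma card_pieces_read D A : #|pieces_read D A| <= kappa.
Proof.
apply: leq_trans (card_qs A); rewrite -sum_nat_const.
have sub: pieces_read D A \subset \bigcup_(q in qs A)
    [set g : 'I_P | has (fun k => piece (F D) k == g) (rd D q)].
  apply/subsetP=> g; rewrite inE => /exists_inP[q Aq has_g].
  by apply/bigcupP; exists q; rewrite ?inE.
apply: leq_trans (subset_leq_card sub) _.
apply: leq_trans (card_bigcup_leq _ _) _; apply: leq_sum => q _.
apply: leq_trans (rd_size D q).
rewrite -(size_map (piece (F D))) cardE -(size_map val); apply: uniq_leq_size.
  by rewrite map_inj_uniq ?enum_uniq //; apply: val_inj.
move=> x /mapP[g]; rewrite mem_enum inE => /hasP[k rd_k /eqP pk] -> /=.
by rewrite -pk map_f.
Qed.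

(** Otherwise [spread] leaves at most [h ^ M] batches to each [kappa]-set of pieces. Every batch
    avoiding [D] reads within such a set, so there would be too few of them. *)
Lemma rich_exposed D : #|BT| <= 2 ^ M.+1 * #|batches D| ->
  exists2 c, sat D c & M * h <= #|exposed D c|.
Proof.
move=> rich; have [/existsP[c /andP[]] |] :=
  boolP [exists c, sat D c && (M * h <= #|exposed D c|)]; first by exists c.
rewrite negb_exists => /forallP poor; suff: #|BT| < #|BT| by rewrite ltnn.
apply: leq_ltn_trans many_batches.
apply: leq_trans rich _; rewrite leq_mul2l; apply/orP; right.
have sub: batches D \subset \bigcup_(C : {set 'I_P} | #|C| == kappa)
    [set A in batches D | pieces_read D A \subset C].
  apply/subsetP=> A DA.
  have [|C subC cardC] := @superset_card _ (pieces_read D A) kappa.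
    by rewrite card_pieces_read card_ord.
  by apply/bigcupP; exists C; rewrite ?cardC // inE DA.
apply: leq_trans (subset_leq_card sub) _.
apply: leq_trans (card_bigcup_leq _ _) _.
have -> : 'C(P, kappa) = #|[set C : {set 'I_P} | #|C| == kappa]|.
  by rewrite card_draws card_ord.
rewrite cardsE -sum_nat_const; apply: leq_sum => C /eqP cardC.
have [|c satc covc] := @cert_of_pieces D C; first by rewrite cardC.
have := poor c; rewrite satc /= -ltnNge => /spread; apply: leq_trans.
apply/subset_leq_card/subsetP => A; rewrite !inE => /andP[disA subC].
apply/bigcupsP=> q Aq; apply: bigcup_sup; apply/andP; split.
  by rewrite disjoint_sym in disA; rewrite disjoint_sym;
     move/bigcup_disjointP: disA; apply.
apply/allP=> k rd_k; have ltkK := rd_lt rd_k.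
have ltp: piece (F D) k < P := leq_ltn_trans (leq_breaks _ ltkK) (F_breaks D).
apply: (covc k (Ordinal ltp)) => //; apply: (subsetP subC); rewrite inE.
by apply/exists_inP; exists q => //; apply/hasP; exists k.
Qed.

Definition rich_sets := [set D | #|BT| <= 2 ^ M.+1 * #|batches D|].

(* Double counting of the pairs (batch, mark set) that are disjoint. *)
Lemma card_rich : 2 ^ #|U| <= 2 ^ M.+1 * #|rich_sets|.
Proof.
have BT0: 0 < #|BT| by apply: leq_ltn_trans many_batches.
(* A batch touches at most [M] vertices, hence avoids at least a fraction [2^-M] of all mark
   sets. *)
have total: #|BT| * 2 ^ #|U| <= 2 ^ M * \sum_D #|batches D|.
  under eq_bigr => D _ do rewrite -sum1dep_card.
  rewrite (exchange_big_dep predT) //= big_distrr /= -sum_nat_const.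
  apply: leq_sum => A _; rewrite sum1dep_card -(card_disjoint_sets (touched A)).
  by rewrite leq_mul2r leq_exp2l ?card_touched ?orbT.
(* A set that is not rich has fewer than [#|BT| / 2^(M+1)] batches, so such sets account for at most
   half of the total. *)
have split_sum: 2 ^ M.+1 * \sum_D #|batches D|
    <= 2 ^ M.+1 * #|rich_sets| * #|BT| + 2 ^ #|U| * #|BT|.
  rewrite (bigID (mem rich_sets)) /= mulnDr -mulnA leq_add //.
    rewrite leq_mul2l -sum_nat_const; apply/orP; right.
    by apply: leq_sum => D _; apply: max_card.
  rewrite big_distrr /= -cardsT -card_powerset powersetT cardsT -sum_nat_const.
  rewrite big_mkcond /=; apply: leq_sum => D _; case: ifP => //.
  by rewrite inE -ltnNge => /ltnW.
rewrite -(leq_pmul2r BT0) -(leq_add2r (2 ^ #|U| * #|BT|)).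
apply: leq_trans split_sum.
by rewrite addnn -mul2n expnS -mulnA leq_mul2l /= mulnC.
Qed.

(** Each rich set satisfies a certificate exposing [M * h] vertices. All sets sharing it avoid the
    vertices exposed by one of them, so they are at most a fraction [2^-(M h)] of all sets, and
    there are too few certificates to cover the rich sets. *)
Theorem no_certificates : False.
Proof.
have sub: rich_sets \subset \bigcup_(c : cert)
    [set D | sat D c && (M * h <= #|exposed D c|)].
  apply/subsetP=> D; rewrite inE => /rich_exposed[c satc big].
  by apply/bigcupP; exists c; rewrite ?inE ?satc.
have class c :
    2 ^ (M * h) * #|[set D | sat D c && (M * h <= #|exposed D c|)]| <= 2 ^ #|U|.
  set X := [set D | _]; have [->|[D0]] := set_0Vmem X; first by rewrite cards0 muln0.
  rewrite inE => /andP[sat0 big0].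
  rewrite -(card_disjoint_sets (exposed D0 c)) leq_mul ?leq_exp2l //.
  apply/subset_leq_card/subsetP=> D; rewrite !inE => /andP[satD _].
  exact: exposed_disjoint.
have count: 2 ^ (M * h) * #|rich_sets| <=
    (K.+1 * K.+1 * Vn.+1) ^ kappa * 2 ^ #|U|.
  have -> : (K.+1 * K.+1 * Vn.+1) ^ kappa = #|{: cert}|.
    by rewrite card_ffun !card_prod !card_ord.
  apply: leq_trans (leq_mul (leqnn _) (subset_leq_card sub)) _.
  apply: leq_trans (leq_mul (leqnn _) (card_bigcup_leq _ _)) _.
  rewrite big_distrr /= -sum_nat_const; exact: leq_sum.
have: 2 ^ (M * h) * 2 ^ #|U| <= 2 ^ M.+1 * (K.+1 * K.+1 * Vn.+1) ^ kappa * 2 ^ #|U|.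
  apply: leq_trans (leq_mul (leqnn _) card_rich) _.
  by rewrite mulnCA -mulnA leq_mul2l count orbT.
by rewrite leq_pmul2r ?expn_gt0 // leqNgt few_certs.
Qed.

End Certificates.

(** * Butterfly batches *)

Section AGM.
Import order ssralg ssrnum ssrint GRing.Theory Num.Theory Order.POrderTheory.

Lemma prod_leq_sum_exp (I : finType) (E : I -> nat) :
  #|I| ^ #|I| * \prod_i E i <= (\sum_i E i) ^ #|I|.
Proof.
have [|le_agm _] := @leif_AGM_scaled int I predT (fun i => Posz (E i)).
  by move=> i _; rewrite -mulr_natr mulr_ge0.
rewrite -(ler_nat int) natrM !natrX natr_sum natr_prod.
move: le_agm; rewrite (eq_bigr (fun i => (#|I|%:R * (E i)%:R)%R)) => [|i _].
  by rewrite big_split /= prodr_const; under [in X in (_ <= X)%R -> _]eq_bigr do rewrite -natz.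
by rewrite mulr_natl (natz (E i)).
Qed.
End AGM.

(** * Base-[B] digits and walks through switches *)

Section Walk.

Variable B : nat.
Hypothesis B_gt0 : 0 < B.

(** In base [B], [lo] fills the digits below [i], [a] is digit [i], and [up] supplies those
    above. *)
Definition splice i lo a up := lo + B ^ i * (a + B * up).

Lemma Bi_gt0 i : 0 < B ^ i. Proof. by rewrite expn_gt0 B_gt0. Qed.
Hint Resolve Bi_gt0 : core.

Lemma splice_mod i lo a up : lo < B ^ i -> splice i lo a up %% B ^ i = lo.
Proof. by move=> lt; rewrite /splice addnC mulnC modnMDl modn_small. Qed.

Lemma splice_div i lo a up : lo < B ^ i -> splice i lo a up %/ B ^ i = a + B * up.
Proof. by move=> lt; rewrite /splice addnC mulnC divnMDl // divn_small // addn0. Qed.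

Lemma splice_divS i lo a up :
  lo < B ^ i -> a < B -> splice i lo a up %/ B ^ i.+1 = up.
Proof.
move=> lt lta; rewrite expnSr divnMA splice_div //.
by rewrite addnC mulnC divnMDl // divn_small // addn0.
Qed.

Lemma splice_dig i lo a up :
  lo < B ^ i -> a < B -> (splice i lo a up %/ B ^ i) %% B = a.
Proof. by move=> lt lta; rewrite splice_div // addnC mulnC modnMDl modn_small. Qed.

Lemma splice_eq i s : s = splice i (s %% B ^ i) ((s %/ B ^ i) %% B) (s %/ B ^ i.+1).
Proof.
rewrite /splice expnSr divnMA [(_ %/ _) %% _ + _]addnC [B * _]mulnC -divn_eq.
by rewrite addnC mulnC -divn_eq.
Qed.

Lemma splice_modS i lo a up :
  lo < B ^ i -> a < B -> splice i lo a up %% B ^ i.+1 = lo + B ^ i * a.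
Proof.
move=> lt lta; rewrite /splice mulnDr addnA addnC mulnA -expnSr mulnC modnMDl.
rewrite modn_small // expnSr; apply: leq_trans (_ : B ^ i * a.+1 <= _).
  by rewrite mulnS addnC [leqRHS]addnC ltn_add2l.
by rewrite leq_mul2l lta orbT.
Qed.

Lemma splice_lt i n lo a up :
  lo < B ^ i -> a < B -> i < n -> up < B ^ (n - i.+1) -> splice i lo a up < B ^ n.
Proof.
move=> lt lta ltin ltup.
have -> : B ^ n = B ^ i * (B * B ^ (n - i.+1)).
  by rewrite -expnS -expnD; congr (_ ^ _); rewrite -subSn // subSS subnKC // ltnW.
rewrite /splice; apply: leq_trans (_ : B ^ i * (a + B * up).+1 <= _).
  by rewrite mulnS addnC [leqRHS]addnC ltn_add2l.
rewrite leq_mul2l; apply/orP; right.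
apply: leq_trans (_ : B * up.+1 <= _); first by rewrite mulnS ltn_add2r.
by rewrite leq_mul2l ltup orbT.
Qed.

Lemma low_div b u : b < B -> (b + B * u) %/ B = u.
Proof. by move=> ltb; rewrite addnC mulnC divnMDl // divn_small // addn0. Qed.

Lemma low_mod b u : b < B -> (b + B * u) %% B = b.
Proof. by move=> ltb; rewrite addnC mulnC modnMDl modn_small. Qed.

Lemma ltn_pmod_exp i s : s %% B ^ i < B ^ i. Proof. by rewrite ltn_pmod. Qed.
Hint Resolve ltn_pmod_exp : core.

Lemma ltn_div_exp i n s : i <= n -> s < B ^ n -> s %/ B ^ i < B ^ (n - i).
Proof. by move=> lein lts; rewrite ltn_divLR // -expnD subnK. Qed.

(* [p i z] is the permutation used at level [i] by the switch [z], whose digits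
   are those of a vertex other than the digits [i] and [i + 1]; [q i z] is its
   inverse. *)
Variables p q : nat -> nat -> nat -> nat.
Hypothesis p_lt : forall i z b, p i z b < B.
Hypothesis q_lt : forall i z a, q i z a < B.
Hypothesis pK : forall i z a, a < B -> p i z (q i z a) = a.

(** Deletes the digits [i] and [i + 1] and closes the gap; what remains names the switch. *)
Definition rest i s := s %% B ^ i + B ^ i * (s %/ B ^ i.+2).

(* The vertex reached from input [b] to output [a] of the switch [z]. *)
Definition node i z a b := splice i (z %% B ^ i) a (b + B * (z %/ B ^ i)).

Lemma node_inj i z a b z' a' b' : a < B -> b < B -> a' < B -> b' < B ->
  node i z a b = node i z' a' b' -> [/\ z = z', a = a' & b = b'].
Proof.
move=> lta ltb lta' ltb' En.
have := congr1 (modn^~ (B ^ i)) En; rewrite /node !splice_mod // => Em.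
have := congr1 (fun n => n %/ B ^ i %% B) En; rewrite /node !splice_dig // => Ea.
have := congr1 (divn^~ (B ^ i.+1)) En; rewrite /node !splice_divS // => Eu.
have := congr1 (modn^~ B) Eu; rewrite /= !low_mod // => Eb.
have := congr1 (divn^~ B) Eu; rewrite /= !low_div // => Ed.
by split=> //; rewrite (divn_eq z (B ^ i)) Ed Em -divn_eq.
Qed.

(** Digit [i] is overwritten by the image of digit [i + 1], which itself is overwritten by the next
    step. Walks start at [B * y], so that digit 0 is free and [y] supplies the others. *)
Definition step i s :=
  splice i (s %% B ^ i) (p i (rest i s) ((s %/ B ^ i.+1) %% B)) (s %/ B ^ i.+1).

Fixpoint walk i s := if i is j.+1 then step j (walk j s) else s.

Lemma rest_mod i s : rest i s %% B ^ i = s %% B ^ i.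
Proof. by rewrite /rest addnC mulnC modnMDl modn_mod. Qed.

Lemma rest_div i s : rest i s %/ B ^ i = s %/ B ^ i.+2.
Proof. by rewrite /rest addnC mulnC divnMDl // [(_ %% _) %/ _]divn_small // addn0. Qed.

Lemma rest_lt i n s : i <= n -> s < B ^ n.+2 -> rest i s < B ^ n.
Proof.
move=> lein lts; have lt2: s %/ B ^ i.+2 < B ^ (n - i).
  by rewrite -[n - i]/(n.+2 - i.+2) ltn_div_exp.
have -> : B ^ n = B ^ i * B ^ (n - i) by rewrite -expnD subnKC.
apply: leq_trans (_ : B ^ i * (s %/ B ^ i.+2).+1 <= _).
  by rewrite /rest mulnS ltn_add2r.
by rewrite leq_mul2l lt2 orbT.
Qed.

Lemma step_node i s :
  step i s = node i (rest i s) (p i (rest i s) ((s %/ B ^ i.+1) %% B))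
                    ((s %/ B ^ i.+1) %% B).
Proof.
rewrite /node rest_mod rest_div /step; congr (splice _ _ _ _).
by rewrite [B ^ i.+2]expnSr divnMA addnC mulnC -divn_eq.
Qed.

Lemma step_mod i s : step i s %% B ^ i = s %% B ^ i.
Proof. by rewrite splice_mod. Qed.

Lemma step_div i s : step i s %/ B ^ i.+1 = s %/ B ^ i.+1.
Proof. by rewrite splice_divS. Qed.

Lemma step_lt i n s : i < n -> s < B ^ n -> step i s < B ^ n.
Proof. by move=> ltin lts; rewrite splice_lt ?ltn_div_exp. Qed.

Lemma walk_lt i n s : i <= n -> s < B ^ n -> walk i s < B ^ n.
Proof.
by elim: i => //= i IHi ltin lts; rewrite step_lt // IHi // ltnW.
Qed.

Lemma walk_div i s : walk i s %/ B ^ i = s %/ B ^ i.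
Proof.
elim: i => //= i IHi; rewrite step_div expnSr !divnMA IHi //.
Qed.

Lemma walk_mod i j s : i <= j -> walk j s %% B ^ i = walk i s %% B ^ i.
Proof.
elim: j => [|j IHj]; first by rewrite leqn0 => /eqP->.
rewrite leq_eqVlt => /predU1P[-> //|]; rewrite ltnS => leij /=.
rewrite -IHj // -(modn_dvdm (step j _) (dvdn_exp2l B leij)) step_mod.
by rewrite modn_dvdm // dvdn_exp2l.
Qed.

(** Later steps keep the digits below [i], the first [i] steps keep the others: each vertex of a
    path is determined by its end and its start. *)
Lemma walk_split i j s : i <= j ->
  walk j s %% B ^ i + B ^ i * (s %/ B ^ i) = walk i s.
Proof.
by move=> leij; rewrite walk_mod // -(walk_div i) addnC mulnC -divn_eq.
Qed.

(** The walk is traced backwards. Digit [i] of [s] is left open, as step [i] overwrites it; in the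
    induction, [b] is the digit that the last step must read to write the prescribed one. *)
Lemma walk_reach i n s : i < n -> s < B ^ n ->
  exists2 y, y < B ^ n.-1 &
    walk i (B * y) %% B ^ i = s %% B ^ i /\
    walk i (B * y) %/ B ^ i.+1 = s %/ B ^ i.+1.
Proof.
elim: i s => [|i IHi] s ltin lts.
  exists (s %/ B); first by rewrite -subn1 -[B in _ %/ B]expn1 ltn_div_exp.
  by rewrite /= expn0 !modn1 expn1 mulnC mulnK.
pose b := q i (rest i s) ((s %/ B ^ i) %% B).
pose s' := splice i.+1 (s %% B ^ i.+1) b (s %/ B ^ i.+2).
have lts': s' < B ^ n by rewrite splice_lt ?q_lt ?ltn_div_exp.
have [y lty [Emod Ediv]] := IHi s' (ltnW ltin) lts'.
exists y => //; rewrite /= /step.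
have Ed: s' %/ B ^ i.+1 = b + B * (s %/ B ^ i.+2) by rewrite splice_div.
have Em: s' %% B ^ i = s %% B ^ i.
  have dv: B ^ i %| B ^ i.+1 by rewrite dvdn_exp2l.
  by rewrite -(modn_dvdm s' dv) splice_mod // modn_dvdm.
have ltb: b < B by apply: q_lt.
have Er: rest i (walk i (B * y)) = rest i s.
  rewrite /rest Emod Em [B ^ i.+2 in LHS]expnSr divnMA Ediv Ed.
  by rewrite low_div.
rewrite Er Ediv Ed Emod Em.
rewrite low_mod // {1}/b pK ?ltn_pmod // -/b splice_modS ?ltn_pmod //; split.
  rewrite {3}(splice_eq i s) splice_modS ?ltn_pmod //.
rewrite [B ^ i.+2]expnSr divnMA splice_divS ?ltn_pmod // -expnSr.
by rewrite low_div.
Qed.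

Lemma node_reach i n z b : i < n -> b < B -> z < B ^ n.-1 ->
  exists2 y, y < B ^ n & walk i.+1 (B * y) = node i z (p i z b) b.
Proof.
move=> ltin ltb ltz; set s := node _ _ _ _.
have ltup: b + B * (z %/ B ^ i) < B ^ (n - i).
  have -> : B ^ (n - i) = B * B ^ (n.-1 - i).
    by rewrite -expnS -subSn ?prednK // ?(leq_trans _ ltin) // -ltnS prednK // (leq_trans _ ltin).
  apply: leq_trans (_ : B * (z %/ B ^ i).+1 <= _).
    by rewrite mulnS ltn_add2r.
  rewrite leq_mul2l ltn_div_exp ?orbT //.
  by rewrite -ltnS prednK // (leq_trans _ ltin).
have lts: s < B ^ n.+1 by rewrite splice_lt // ltnW.
have [y lty [Emod Ediv]] := walk_reach (n := n.+1) (ltnW ltin) lts.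
exists y => //=; rewrite /step Emod Ediv.
have Es: s %/ B ^ i.+1 = b + B * (z %/ B ^ i) by rewrite splice_divS.
have Em: s %% B ^ i = z %% B ^ i by rewrite splice_mod.
have -> : rest i (walk i (B * y)) = z.
  rewrite /rest Emod Em [B ^ i.+2]expnSr divnMA Ediv Es.
  by rewrite low_div // addnC mulnC -divn_eq.
by rewrite Es Em low_mod.
Qed.

End Walk.

Lemma card_ffun_in (aT rT : finType) (F : aT -> {set rT}) :
  #|[set f : {ffun aT -> rT} | [forall x, f x \in F x]]| = \prod_x #|F x|.
Proof.
have -> : \prod_x #|F x| = #|family (fun x => mem (F x))|.
  by rewrite card_family foldrE big_map big_enum.
by apply: eq_card => f; rewrite inE; apply/forallP/familyP.
Qed.

(** * Batches as families of permutations *)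

Section Butterfly.

Variables B' R' : nat.
Local Notation B := B'.+1.
Local Notation R := R'.+1.
Local Notation Z := (B ^ R').
Local Notation N := (B ^ R.+1).

Lemma Z_gt0 : 0 < Z. Proof. by rewrite expn_gt0. Qed.
Lemma N_gt0 : 0 < N. Proof. by rewrite expn_gt0. Qed.

Definition batch := {ffun 'I_R * 'I_Z -> {perm 'I_B}}.

Definition perm_at (A : batch) (i z : nat) : {perm 'I_B} :=
  A (inord i, insubd (Ordinal Z_gt0) z).

Definition bfwd A i z b : nat := perm_at A i z (inord b).
Definition bbwd A i z a : nat := (perm_at A i z)^-1%g (inord a).

Lemma bfwd_lt A i z b : bfwd A i z b < B. Proof. exact: ltn_ord. Qed.
Lemma bbwd_lt A i z b : bbwd A i z b < B. Proof. exact: ltn_ord. Qed.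
Lemma bfwdK A i z a : a < B -> bfwd A i z (bbwd A i z a) = a.
Proof. by move=> lta; rewrite /bfwd /bbwd inord_val permKV inordK. Qed.

Lemma bfwdE (A : batch) (i : 'I_R) (z : 'I_Z) (b : 'I_B) : bfwd A i z b = A (i, z) b.
Proof.
by rewrite /bfwd /perm_at !inord_val; congr (val (A (_, _) _)); apply: valKd.
Qed.

(* The vertex of level [i] on the path of leaf [X] at time [y]: its low digits are
   those of [X], its high digits those of [y]. *)
Definition elem (X y i : nat) := X %% B ^ i.+1 + B ^ i.+1 * (y %/ B ^ i.+1).

Definition els (q : 'I_N * 'I_N) : {set 'I_R * 'I_N} :=
  [set e : 'I_R * 'I_N | e.2 == elem q.1 q.2 e.1 :> nat].

Lemma query_time_lt (y : 'I_(B ^ R)) : B * y < N.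
Proof. by have := ltn_ord y; rewrite [N]expnS ltn_pmul2l. Qed.

Lemma query_leaf_lt A (y : 'I_(B ^ R)) : walk B (bfwd A) R (B * y) < N.
Proof. by rewrite walk_lt ?query_time_lt //; apply: bfwd_lt. Qed.

Definition query A y : 'I_N * 'I_N :=
  (Ordinal (query_leaf_lt A y), Ordinal (query_time_lt y)).

Definition qs A : {set 'I_N * 'I_N} := [set query A y | y : 'I_(B ^ R)].

Lemma card_qs A : #|qs A| <= B ^ R.
Proof. by apply: leq_trans (leq_imset_card _ _) _; rewrite cardT size_enum_ord. Qed.

Lemma elem_query A y (i : 'I_R) :
  elem (query A y).1 (query A y).2 i = walk B (bfwd A) i.+1 (B * y).
Proof. by rewrite /elem walk_split //; apply: bfwd_lt. Qed.

Lemma node_lt (A : batch) (i : 'I_R) (z : 'I_Z) (b : 'I_B) : node B i z (A (i, z) b) b < N.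
Proof.
have lt_i := ltn_ord i; rewrite /node splice_lt ?ltn_pmod ?expn_gt0 //; first exact: leqW.
have -> : B ^ (R.+1 - i.+1) = B * B ^ (R' - i) by rewrite subSS subSn // expnS.
apply: leq_trans (_ : B * (z %/ B ^ i).+1 <= _); first by rewrite mulnS ltn_add2r.
by rewrite leq_pmul2l // ltn_div_exp.
Qed.

Definition graph_elem (A : batch) (x : 'I_R * 'I_Z * 'I_B) : 'I_R * 'I_N :=
  (x.1.1, Ordinal (node_lt A x.1.1 x.1.2 x.2)).

(** [step_node] puts each vertex of a path on the graph of a permutation, and [node_reach] finds a
    query through each point of these graphs. Lying inside a set thus becomes a condition on each
    input separately. *)
Lemma touchedE A : touched els qs A = [set graph_elem A x | x : 'I_R * 'I_Z * 'I_B].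
Proof.
apply/setP=> -[i s]; apply/bigcupP/imsetP => [[_ /imsetP[y _ ->]] | [[[i' z] b] _]].
  rewrite inE elem_query => /eqP /= Es; move: Es.
  rewrite step_node //; set w := walk _ _ _ _.
  have ltw: w < N.
    apply: walk_lt => //; [exact: bfwd_lt | exact: leqW (ltnW _) | exact: query_time_lt].
  have ltz: rest B i w < Z by rewrite rest_lt // -ltnS ltn_ord.
  have ltb: (w %/ B ^ i.+1) %% B < B by rewrite ltn_mod.
  have := bfwdE A i (Ordinal ltz) (Ordinal ltb); rewrite /= => -> Es.
  exists (i, Ordinal ltz, Ordinal ltb) => //; congr (_, _).
  exact: val_inj.
case=> -> Es; have [y lty Ey] := node_reach (ltn0Sn B') (bfwd_lt A) (bbwd_lt A) (@bfwdK A)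
  (ltn_ord i') (ltn_ord b) (ltn_ord z).
exists (query A (Ordinal lty)); first exact: imset_f.
by rewrite inE elem_query Es Ey /= bfwdE.
Qed.

Lemma card_touched A : #|touched els qs A| <= R * B ^ R.
Proof.
rewrite touchedE (leq_trans (leq_imset_card _ _)) // cardT -cardE.
by rewrite !card_prod !card_ord -mulnA -expnSr.
Qed.

Definition allowed (V : {set 'I_R * 'I_N}) (x : 'I_R * 'I_Z * 'I_B) : {set 'I_B} :=
  [set a : 'I_B | [exists s : 'I_N,
     (s == node B x.1.1 x.1.2 a x.2 :> nat) && ((x.1.1, s) \in V)]].

Lemma sum_allowed V : \sum_x #|allowed V x| <= #|V|.
Proof.
pose W := [set xa : ('I_R * 'I_Z * 'I_B) * 'I_B | xa.2 \in allowed V xa.1].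
have -> : \sum_x #|allowed V x| = #|W|.
  rewrite -sum1_card (eq_bigl (fun xa => predT xa.1 && (xa.2 \in allowed V xa.1))).
    rewrite -(pair_big_dep predT (fun x a => a \in allowed V x) (fun _ _ => 1)) /=.
    by apply: eq_bigr => x _; rewrite sum1_card.
  by move=> xa; rewrite inE.
pose f (xa : ('I_R * 'I_Z * 'I_B) * 'I_B) : 'I_R * 'I_N :=
  (xa.1.1.1, insubd (Ordinal N_gt0) (node B xa.1.1.1 xa.1.1.2 xa.2 xa.1.2)).
have fW xa : xa \in W -> f xa \in V /\
    val (f xa).2 = node B xa.1.1.1 xa.1.1.2 xa.2 xa.1.2.
  rewrite inE inE => /existsP[s /andP[/eqP Es Vs]]; rewrite /f -Es valKd.
  by [].
rewrite -(@card_in_imset _ _ f W).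
  by apply/subset_leq_card/subsetP=> _ /imsetP[xa /fW[Vf _] ->].
move=> [[[i z] b] a] [[[i' z'] b'] a'] /fW[_ /= E1] /fW[_ /= E2] [Ei Es].
have := E1; rewrite /f /= in Es E1 E2 *; rewrite Es E2 => En.
have [/val_inj-> /val_inj-> /val_inj->] : [/\ z' = z :> nat, a' = a :> nat & b' = b :> nat].
  by apply: (@node_inj B (ltn0Sn B') i'); rewrite ?ltn_ord // En Ei.
by rewrite Ei.
Qed.

(** Batches inside [V] number at most the product of the [#|allowed V x|], the injectivity of
    permutations being forgotten. The [R * B ^ R] factors have average below [h], and AM-GM
    applies. *)
Lemma spread (V : {set 'I_R * 'I_N}) h : #|V| < R * B ^ R * h ->
  #|[set A | touched els qs A \subset V]| <= h ^ (R * B ^ R).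
Proof.
move=> ltV; set M := R * B ^ R.
have M_gt0: 0 < M by rewrite muln_gt0 expn_gt0.
have cardI: #|{: 'I_R * 'I_Z * 'I_B}| = M.
  by rewrite !card_prod !card_ord -mulnA -expnSr.
have agm: \prod_x #|allowed V x| <= h ^ M.
  have := prod_leq_sum_exp (fun x => #|allowed V x|); rewrite cardI => le_agm.
  rewrite -(@leq_pmul2l (M ^ M)) ?expn_gt0 ?M_gt0 // -expnMn.
  apply: leq_trans le_agm _; rewrite leq_exp2r //.
  exact: leq_trans (sum_allowed V) (ltnW ltV).
apply: leq_trans agm.
pose G (x : 'I_R * 'I_Z) : {set {perm 'I_B}} :=
  [set s : {perm 'I_B} | [forall b, s b \in allowed V (x, b)]].
have cardG x : #|G x| <= \prod_b #|allowed V (x, b)|.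
  rewrite -card_ffun_in -(card_imset _ val_inj).
  apply/subset_leq_card/subsetP=> _ /imsetP[s Gs ->].
  move: Gs; rewrite !inE => /forallP Gs; apply/forallP=> b.
  by have := Gs b; rewrite pvalE.
apply: leq_trans (_ : \prod_x #|G x| <= _).
  rewrite -card_ffun_in; apply/subset_leq_card/subsetP=> A; rewrite inE touchedE => /subsetP subV.
  rewrite inE; apply/forallP=> -[i z]; rewrite inE; apply/forallP=> b; rewrite inE.
  apply/existsP; exists (Ordinal (node_lt A i z b)); rewrite /= eqxx /=.
  exact: (subV (graph_elem A (i, z, b)) (imset_f _ _)).
have -> : \prod_x #|allowed V x| = \prod_x \prod_b #|allowed V (x, b)|.
  by rewrite pair_bigA; apply: eq_bigr => -[].
exact: leq_prod.
Qed.

End Butterfly.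

(** * Cell probes *)

Lemma ltbE a b : Nat.ltb a b = (a < b).
Proof. by apply/idP/idP => [/PeanoNat.Nat.ltb_lt/ltP | /ltP/PeanoNat.Nat.ltb_lt]. Qed.

Lemma powE a b : Nat.pow a b = a ^ b.
Proof. by elim: b => //= b ->; rewrite expnS. Qed.

Section Run.
Variables (A : Type) (sp w : nat).

Fixpoint reads (m : memory) (p : prog A) : seq nat :=
  match p with
  | Ret _ => [::]
  | Rd x k => x :: reads m (k (m x))
  | Wr x v p' => reads (mem_upd m x v) p'
  end.

Lemma run_reads m (p : prog A) m' a c : run sp w m p = Some (m', a, c) ->
  size (reads m p) <= c /\ {in reads m p, forall x, x < sp}.
Proof.
elim: p m m' a c => [b|x k IHk|x v p IHp] m m' a c /=.
- by case=> _ _ <-.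
- rewrite ltbE; case: ifP => // lt_x.
  case E: run => [[[m1 a1] c1]|] // [_ _ <-]; have [le_c lt_r] := IHk _ _ _ _ _ E.
  by split=> // y; rewrite inE => /predU1P[-> // | /lt_r].
- case: ifP => // _; case E: run => [[[m1 a1] c1]|] // [_ _ <-].
  by have [le_c lt_r] := IHp _ _ _ _ E; split=> //; apply: leqW.
Qed.

(** Both runs branch alike while the contents read agree, and a write changes both memories
    alike. *)
Lemma run_local m1 m2 (p : prog A) m' a c :
  run sp w m1 p = Some (m', a, c) -> {in reads m1 p, m1 =1 m2} ->
  exists m'', run sp w m2 p = Some (m'', a, c).
Proof.
elim: p m1 m2 m' a c => [b|x k IHk|x v p IHp] m1 m2 m' a c /=.
- by case=> _ <- <- _; exists m2.
- case: ifP => // _; case E: run => [[[m3 a3] c3]|] // [_ <- <-] eq_m.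
  rewrite -(eq_m x) ?mem_head //.
  have [|m4 ->] := IHk _ _ m2 _ _ _ E; last by exists m4.
  by move=> y y_r; apply: eq_m; rewrite inE y_r orbT.
- case: ifP => // _; case E: run => [[[m3 a3] c3]|] // [_ <- <-] eq_m.
  have [|m4 ->] := IHp _ (mem_upd m2 x v) _ _ _ E; last by exists m4.
  by move=> y y_r; rewrite /mem_upd eq_m.
Qed.

Lemma run_bounded m (p : prog A) m' a c : run sp w m p = Some (m', a, c) ->
  (forall x, x < sp -> m x < 2 ^ w) -> forall x, x < sp -> m' x < 2 ^ w.
Proof.
elim: p m m' a c => [b|x k IHk|x v p IHp] m m' a c /=.
- by case=> <-.
- case: ifP => // _; case E: run => [[[m3 a3] c3]|] // [<- _ _].
  exact: IHk E.
- rewrite !ltbE powE; case: ifP => // /andP[ltx ltv].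
  case E: run => [[[m3 a3] c3]|] // [<- _ _] lt_m; apply: IHp E _ => y lty.
  by rewrite /mem_upd; case: ifP => // _; apply: lt_m.
Qed.

Definition diff (m m' : memory) := \sum_(0 <= x < sp) (m x != m' x).

Lemma diffxx m : diff m m = 0.
Proof. by rewrite /diff big1 // => x _; rewrite eqxx. Qed.

Lemma diff_trans m1 m2 m3 : diff m1 m3 <= diff m1 m2 + diff m2 m3.
Proof.
rewrite /diff -big_split /=; apply: leq_sum => x _.
by case: (eqVneq (m1 x) (m2 x)) => [-> | _]; rewrite ?add0n //=; case: (_ != _).
Qed.

Lemma diff_upd m x v : diff m (mem_upd m x v) <= 1.
Proof.
rewrite /diff; apply: leq_trans (_ : \sum_(0 <= y < sp) (y == x) <= _).
  apply: leq_sum => y _; rewrite /mem_upd.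
  case: (PeanoNat.Nat.eqb_spec y x) => [-> | _]; rewrite ?eqxx //.
  exact: leq_b1.
rewrite big_mkord; have [ltx | gex] := ltnP x sp.
  rewrite (bigD1 (Ordinal ltx)) //= eqxx big1 // => y.
  by rewrite -val_eqE /= => /negbTE->.
by rewrite big1 // => y _; rewrite ltn_eqF // (leq_trans (ltn_ord y)).
Qed.

Lemma run_diff m (p : prog A) m' a c : run sp w m p = Some (m', a, c) -> diff m m' <= c.
Proof.
elim: p m m' a c => [b|x k IHk|x v p IHp] m m' a c /=.
- by case=> -> _ <-; rewrite diffxx.
- case: ifP => // _; case E: run => [[[m3 a3] c3]|] // [<- _ <-].
  exact/leqW/(IHk _ _ _ _ _ E).
- case: ifP => // _; case E: run => [[[m3 a3] c3]|] // [<- _ <-].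
  apply: leq_trans (diff_trans _ (mem_upd m x v) _) _.
  by rewrite -add1n leq_add ?diff_upd // (IHp _ _ _ _ E).
Qed.

End Run.

(** * The memory over time as one function *)

Section Snapshots.
Variables (sp n : nat) (mem : nat -> memory).

Definition cell_key a s := a * n.+1 + s.

(* The value 0 stands for the initial content, so that the cells that are never
   written do not contribute any break. *)
Definition history k :=
  let v := mem (k %% n.+1) (k %/ n.+1) in
  if v == mem 0 (k %/ n.+1) then 0 else v.+1.

Lemma historyE a s : s <= n ->
  history (cell_key a s) = if mem s a == mem 0 a then 0 else (mem s a).+1.
Proof.
move=> les; rewrite /history /cell_key modnMDl modn_small ?ltnS //.
by rewrite divnMDl // divn_small ?ltnS // addn0.
Qed.

Lemma leq_history_change a s : s < n ->
  (history (cell_key a s.+1) != history (cell_key a s)) <= (mem s a != mem s.+1 a).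
Proof.
move=> lts; rewrite !historyE //; last exact: ltnW.
by case: (eqVneq (mem s a) (mem s.+1 a)) => [->|_]; rewrite ?eqxx ?leq_b1.
Qed.

Lemma row_changes a :
  (mem 0 a != mem n a) <= \sum_(0 <= s < n) (mem s a != mem s.+1 a).
Proof.
elim: n => [|m IHm]; first by rewrite eqxx.
rewrite big_nat_recr //=; apply: leq_trans (leq_add IHm (leqnn _)).
case: (eqVneq (mem 0 a) (mem m a)) => [->|_]; first by rewrite add0n.
by case: (_ != _).
Qed.

(** A change of a cell costs at most one break inside its row. The next row starts at value 0, which
    makes a break only if the cell has changed; hence the factor 2. *)
Lemma breaks_history :
  breaks history (sp * n.+1) <= 2 * \sum_(0 <= s < n) diff sp (mem s) (mem s.+1).
Proof.
rewrite /diff exchange_big_nat /= mul2n -addnn /breaks big_nat_mul.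
pose ch a := \sum_(0 <= s < n) (mem s a != mem s.+1 a).
apply: leq_trans (_ : \sum_(0 <= a < sp) ((if a is b.+1 then ch b else 0) + ch a) <= _).
  apply: leq_sum => a _; rewrite -{1}[a * n.+1]add0n.
  rewrite big_addn -mulnBl subSnn mul1n big_nat_recl // leq_add //; last first.
    rewrite /ch big_nat [leqRHS]big_nat; apply: leq_sum => s /andP[_ lts].
    rewrite addSn /= [s + _]addnC -addnS.
    exact: (leq_history_change a lts).
  rewrite add0n; case: a => [|a]; first by rewrite eqxx.
  have -> : (a.+1 * n.+1).-1 = cell_key a n by rewrite mulSn addSn addnC.
  rewrite -[a.+1 * _]addn0 -/(cell_key _ _) !historyE // eqxx.
  apply: leq_trans (row_changes a); rewrite [mem 0 a == _]eq_sym.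
  by case: (mem n a == mem 0 a).
rewrite big_split leq_add2r; case: sp => [|sp']; first by rewrite !big_geq.
by rewrite [leqLHS]big_nat_recl //= ?add0n [leqRHS]big_nat_recr //= leq_addr.
Qed.

End Snapshots.

(** * The gadget *)

Lemma length_size (T : Type) (s : seq T) : length s = size s.
Proof. by []. Qed.

Lemma firstnE (T : Type) n (s : seq T) : List.firstn n s = take n s.
Proof. by elim: n s => [|n IHn] [|x s] //=; rewrite IHn. Qed.

Lemma skipnE (T : Type) n (s : seq T) : List.skipn n s = drop n s.
Proof. by elim: n s => [|n IHn] [|x s] //=. Qed.

Lemma size_subst_letter s i c : i < size s -> size (subst_letter s i c) = size s.
Proof.
move=> lti; rewrite /subst_letter firstnE skipnE.
by rewrite size_cat size_take lti /= size_drop; lia.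
Qed.

Lemma nth_subst_letter s i c k : i < size s ->
  nth 0 (subst_letter s i c) k = if k == i then c else nth 0 s k.
Proof.
move=> lti; rewrite /subst_letter firstnE skipnE nth_cat size_take lti.
case: (ltngtP k i) => [ltk | gtk | ->]; first by rewrite nth_take.
  have -> : k - i = (k - i.+1).+1 by lia.
  by rewrite /= nth_drop; congr nth; lia.
by rewrite subnn.
Qed.

Lemma common_atP S T i j l :
  common_at S T i j l <->
  [/\ i + l <= size S, j + l <= size T &
      forall k, k < l -> nth 0 S (i + k) = nth 0 T (j + k)].
Proof.
rewrite /common_at /substr !firstnE !skipnE; split.
  case=> /leP leS [/leP leT eqST]; split=> // k ltk.
  by rewrite -nth_drop -(nth_take 0 ltk) eqST nth_take // nth_drop.
case=> leS leT eqST; split; [exact/leP | split; first exact/leP].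
apply: (@eq_from_nth _ 0) => [|k].
  by rewrite !size_takel // size_drop leq_subRL ?(leq_trans _ leS) ?(leq_trans _ leT) ?leq_addr.
rewrite size_takel => [ltk|]; last by rewrite size_drop; lia.
by rewrite !nth_take // !nth_drop eqST.
Qed.

Lemma divn_mod_inj d q r q' r' : r < d -> r' < d ->
  q * d + r = q' * d + r' -> q = q' /\ r = r'.
Proof.
move=> ltr ltr' E; have d_gt0: 0 < d by apply: leq_ltn_trans ltr.
have := congr1 (divn^~ d) E; have := congr1 (modn^~ d) E.
rewrite /= !modnMDl !divnMDl // (modn_small ltr) (modn_small ltr').
by rewrite (divn_small ltr) (divn_small ltr') !addn0.
Qed.

Section Gadget.

(* Letters: 0 is padding, 1 the activation mark, 2 an unmarked vertex,
   3 an inactive leaf, 4 a terminator occurring in the second string only, and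
   [path_letter j v] stands for the vertex [v] of level [j]. *)
Variables B R N : nat.
Hypothesis N_gt0 : 0 < N.

Definition path_letter j v := 5 + (j * N + v).

Definition leaf_letter p :=
  let X := p %/ (2 * R).+1 in let k := p %% (2 * R).+1 in
  if k < R then 0 else if k == R then 3
  else path_letter (k - R.+1) (X %% B ^ (k - R.+1).+1).

(** A block of level [i] has [R - i - 1] paddings, the mark, the path letters of levels 0 to [i],
    and the terminator. The padding equalizes the lengths and matches the padding before the
    activation mark. *)
Definition vertex_letter (mu : nat -> nat -> bool) p :=
  let e := p %/ R.+2 in let k := p %% R.+2 in
  let i := e %/ N in let u := e %% N in
  if k < R - i.+1 then 0 else if k == R - i.+1 then (if mu i u then 1 else 2)
  else if k <= R then path_letter (k - (R - i)) (u %% B ^ (k - (R - i)).+1)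
  else 4.

Definition leaf_string := mkseq leaf_letter (N * (2 * R).+1).
Definition vertex_string mu := mkseq (vertex_letter mu) (R * N * R.+2).

Definition leaf_pos X := X * (2 * R).+1 + R.
Definition vertex_pos i u := (i * N + u) * R.+2 + (R - i.+1).

Lemma leaf_letterE X k : k < (2 * R).+1 -> leaf_letter (X * (2 * R).+1 + k) =
  if k < R then 0 else if k == R then 3
  else path_letter (k - R.+1) (X %% B ^ (k - R.+1).+1).
Proof.
move=> ltk; rewrite /leaf_letter divnMDl // divn_small // addn0.
by rewrite modnMDl modn_small.
Qed.

Lemma vertex_letterE mu i u k : u < N -> k < R.+2 ->
  vertex_letter mu ((i * N + u) * R.+2 + k) =
  if k < R - i.+1 then 0 else if k == R - i.+1 then (if mu i u then 1 else 2)
  else if k <= R then path_letter (k - (R - i)) (u %% B ^ (k - (R - i)).+1)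
  else 4.
Proof.
move=> ltu ltk; rewrite /vertex_letter.
have -> : ((i * N + u) * R.+2 + k) %/ R.+2 = i * N + u.
  by rewrite divnMDl // divn_small // addn0.
have -> : ((i * N + u) * R.+2 + k) %% R.+2 = k by rewrite modnMDl modn_small.
by rewrite divnMDl // divn_small // addn0 modnMDl modn_small.
Qed.

Lemma leaf_pos_lt X : X < N -> leaf_pos X < N * (2 * R).+1.
Proof. by rewrite /leaf_pos; nia. Qed.

Lemma vertex_pos_lt i u : i < R -> u < N -> vertex_pos i u < R * N * R.+2.
Proof.
move=> lti ltu; rewrite /vertex_pos.
have : (i * N + u).+1 * R.+2 <= R * N * R.+2 by rewrite leq_mul2r; nia.
by rewrite mulSn; lia.
Qed.

Lemma leaf_letter_lt p : p < N * (2 * R).+1 -> leaf_letter p < 5 + R * N.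
Proof.
move=> ltp; rewrite (divn_eq p (2 * R).+1) leaf_letterE ?ltn_mod //.
have ltX : p %/ (2 * R).+1 < N by rewrite ltn_divLR.
have ltk := ltn_mod p (2 * R).+1; rewrite /= in ltk.
case: ifP => [|/negbT]; first by lia.
rewrite -leqNgt => leR; case: eqP => [|neR]; first by lia.
rewrite /path_letter ltn_add2l.
have := leq_mod (p %/ (2 * R).+1) (B ^ (p %% (2 * R).+1 - R.+1).+1).
have : (p %% (2 * R).+1 - R.+1).+1 * N <= R * N by rewrite leq_mul2r; lia.
by rewrite mulSn; lia.
Qed.

Lemma vertex_letter_lt mu p : p < R * N * R.+2 -> vertex_letter mu p < 5 + R * N.
Proof.
move=> ltp; rewrite /vertex_letter.
have lte : p %/ R.+2 < R * N by rewrite ltn_divLR.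
have lti : p %/ R.+2 %/ N < R by rewrite ltn_divLR.
have ltu : p %/ R.+2 %% N < N by rewrite ltn_mod.
case: ifP => // /negbT; rewrite -leqNgt => le1; case: eqP => [|ne1]; first by case: ifP.
case: ifP => // le2; rewrite /path_letter ltn_add2l.
set k := _ - _; have := leq_mod (p %/ R.+2 %% N) (B ^ k.+1).
have : k.+1 * N <= R * N by rewrite leq_mul2r; lia.
by rewrite mulSn; lia.
Qed.

Lemma subst_vertex mu mu' i u b : i < R -> u < N ->
  (forall i' u', mu' i' u' =
     if (i' == i) && (u' == u) then b else mu i' u') ->
  subst_letter (vertex_string mu) (vertex_pos i u) (if b then 1 else 2) =
  vertex_string mu'.
Proof.
move=> lti ltu Emu; have lt_pos := vertex_pos_lt lti ltu.
have sz: vertex_pos i u < size (vertex_string mu) by rewrite size_mkseq.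
apply: (@eq_from_nth _ 0); first by rewrite size_subst_letter // !size_mkseq.
rewrite size_subst_letter // size_mkseq => p ltp.
rewrite nth_subst_letter // !nth_mkseq //.
have lte : p %/ R.+2 < R * N by rewrite ltn_divLR.
have lti' : p %/ R.+2 %/ N < R by rewrite ltn_divLR.
have ltu' : p %/ R.+2 %% N < N by rewrite ltn_mod.
have Ep: p = (p %/ R.+2 %/ N * N + p %/ R.+2 %% N) * R.+2 + p %% R.+2.
  by rewrite -divn_eq -divn_eq.
have ltk : p %% R.+2 < R.+2 by rewrite ltn_mod.
move: (p %/ R.+2 %/ N) (p %/ R.+2 %% N) (p %% R.+2) lti' ltu' ltk Ep.
move=> i' u' k lti' ltu' ltk ->; rewrite !vertex_letterE //.
case: eqP => [Ep | ne].
  have [||Ee Ek] := divn_mod_inj _ _ Ep; try lia.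
  by have [|| -> ->] := divn_mod_inj _ _ Ee; rewrite // Emu !eqxx Ek ltnn eqxx.
case: (k < R - i'.+1) => //; case: (eqVneq k (R - i'.+1)) => // Ek; rewrite Emu.
case: (eqVneq i' i) => //= Ei; case: (eqVneq u' u) => // Eu.
by case: ne; rewrite Ek Ei Eu.
Qed.

(* A substring of the second string of length [R.+1] without terminator is a whole
   block, and contains exactly one mark letter. *)
Lemma lcs_gadget mu X T i j l : X < N -> T = vertex_string mu ->
  (forall i u, i < R -> mu i u -> u < B ^ i.+1) ->
  is_lcs (subst_letter leaf_string (leaf_pos X) 1) T (i, j, l) ->
  (R < l) = [exists d : 'I_R, mu d (X %% B ^ d.+1)].
Proof.
move=> ltX -> mu_small; have lt_pos := leaf_pos_lt ltX.
have szS: leaf_pos X < size leaf_string by rewrite size_mkseq.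
have nthS p : p < N * (2 * R).+1 -> nth 0 (subst_letter leaf_string (leaf_pos X) 1) p
    = if p == leaf_pos X then 1 else leaf_letter p.
  by move=> ltp; rewrite nth_subst_letter // nth_mkseq.
rewrite /is_lcs => -[com maxl]; apply/idP/existsP => [ltRl | [[d ltd] /= mud]].
  have /common_atP[leS leT eqST] := com.
  rewrite size_subst_letter // !size_mkseq in leS leT.
  have eqL k : k <= R -> (if i + k == leaf_pos X then 1 else leaf_letter (i + k))
      = vertex_letter mu (j + k).
    move=> lek; rewrite -nthS; last by lia.
    by rewrite eqST ?nth_mkseq //; lia.
  have S_not p c : p < N * (2 * R).+1 -> (c == 2) || (c == 4) -> 
      (if p == leaf_pos X then 1 else leaf_letter p) <> c.
    move=> _ c24; case: ifP => _; first by case/orP: c24 => /eqP->.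
    rewrite /leaf_letter /path_letter; case: ifP => _; first by case/orP: c24 => /eqP->.
    by case: ifP => _; case/orP: c24 => /eqP->.
  have lte : j %/ R.+2 < R * N by rewrite ltn_divLR //; lia.
  have ltd : j %/ R.+2 %/ N < R by rewrite ltn_divLR.
  have ltu : j %/ R.+2 %% N < N by rewrite ltn_mod.
  have Ej: j = (j %/ R.+2 %/ N * N + j %/ R.+2 %% N) * R.+2 + j %% R.+2.
    by rewrite -divn_eq -divn_eq.
  have ltr : j %% R.+2 < R.+2 by rewrite ltn_mod.
  move: (j %/ R.+2 %/ N) (j %/ R.+2 %% N) (j %% R.+2) ltd ltu ltr Ej.
  move=> d u r ltd ltu ltr Ej.
  (* Otherwise the window of length [R.+1] contains the terminator, which the first string lacks. *)
  have r0 : r = 0.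
    apply/eqP; rewrite -leqn0 leqNgt; apply/negP => r_gt0.
    have le_k : R.+1 - r <= R by lia.
    have Er : r + (R.+1 - r) = R.+1 by lia.
    have := eqL _ le_k; rewrite Ej -addnA Er vertex_letterE // ltnn.
    have -> : (R.+1 < R - d.+1) = false by lia.
    have -> : (R.+1 == R - d.+1) = false by lia.
    by apply: S_not; lia.
  rewrite r0 addn0 in Ej.
  (* The first string has no letter 2, and has 1 only at the activated leaf: the mark is set and the
     alignment fixed. *)
  have le_k : R - d.+1 <= R by apply: leq_subr.
  have := eqL _ le_k; rewrite Ej vertex_letterE //; last by lia.
  rewrite ltnn eqxx; case mudu: (mu d u) => E1; last first.
    by case: (S_not (i + (R - d.+1)) 2 _ _ E1) => //; lia.
  exists (Ordinal ltd) => /=; suff <- : u = X %% B ^ d.+1 by [].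
  have Epos : i + (R - d.+1) = leaf_pos X.
    move: E1; case: eqP => // _; rewrite /leaf_letter /path_letter.
    by case: ifP => //; case: ifP.
  (* The last letter of the window, of level [d], identifies [u] as the ancestor of [X]. *)
  have := eqL R (leqnn R); rewrite Ej vertex_letterE //.
  have -> : i + R = X * (2 * R).+1 + (R.+1 + d) by rewrite /leaf_pos in Epos; lia.
  rewrite (_ : (_ == leaf_pos X) = false); last by rewrite /leaf_pos; lia.
  rewrite leaf_letterE; last by lia.
  have -> : (R.+1 + d < R) = false by lia.
  have -> : (R.+1 + d == R) = false by lia.
  have -> : (R < R - d.+1) = false by lia.
  have -> : (R == R - d.+1) = false by lia.
  have -> : R.+1 + d - R.+1 = d by lia.
  have -> : R - (R - d) = d by lia.
  rewrite leqnn /path_letter => /addnI/addnI ->.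
  by rewrite modn_small // mu_small.
have ltM : X %% B ^ d.+1 < N by apply: leq_ltn_trans (leq_mod _ _) ltX.
have pos_lt := vertex_pos_lt ltd ltM; rewrite /vertex_pos in pos_lt.
apply: (leq_trans _ (_ : R.+1 <= l)) => //; apply/leP.
(* This start puts the activation mark opposite the mark of the vertex. *)
apply: (maxl (X * (2 * R).+1 + d.+1) ((d * N + X %% B ^ d.+1) * R.+2)).
apply/common_atP; rewrite size_subst_letter // !size_mkseq.
have bS : X * (2 * R).+1 + d.+1 + R.+1 <= N * (2 * R).+1.
  have : X.+1 * (2 * R).+1 <= N * (2 * R).+1 by rewrite leq_mul2r ltX orbT.
  by rewrite mulSn; lia.
have bT : (d * N + X %% B ^ d.+1) * R.+2 + R.+1 <= R * N * R.+2.
  have : (d * N + X %% B ^ d.+1).+1 * R.+2 <= R * N * R.+2.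
    by rewrite leq_mul2r; nia.
  by rewrite mulSn; lia.
split=> // k; rewrite ltnS => lek.
rewrite nthS ?nth_mkseq; try lia.
rewrite vertex_letterE //; last by lia.
rewrite -[X * _ + _ + _]addnA; case: eqP => [Ek | ne].
  have -> : k = R - d.+1 by rewrite /leaf_pos in Ek; lia.
  by rewrite ltnn eqxx mud.
rewrite leaf_letterE; last by lia.
case: (ltngtP k (R - d.+1)) => [ltk | gtk | Ek].
- by rewrite ifT //; lia.
- have -> : (d.+1 + k < R) = false by lia.
  have -> : (d.+1 + k == R) = false by lia.
  have -> : d.+1 + k - R.+1 = k - (R - d) by lia.
  rewrite lek.
  by rewrite modn_dvdm // dvdn_exp2l //; lia.
- by case: ne; rewrite /leaf_pos Ek; lia.
Qed.


End Gadget.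

(** * The update sequence *)

Section Timeline.

Variables (DS : lcs_ds) (n sp w t : nat).

Definition run_op (m : memory) (o : nat * nat) : memory :=
  if run sp w m (ds_upd DS true o.1 o.2) is Some (m', _, _) then m' else m.
Definition run_ops := foldl run_op.
Definition subst_ops := foldl (fun T (o : nat * nat) => subst_letter T o.1 o.2).

Lemma behaves_ops os rest m S T :
  behaves DS n sp w t m S T ([seq (true, o.1, o.2) | o <- os] ++ rest) ->
  {in os, forall o, o.1 < size T /\ o.2 < n} ->
  [/\ behaves DS n sp w t (run_ops m os) S (subst_ops T os) rest,
      diff sp m (run_ops m os) <= t * size os &
      (forall x, x < sp -> m x < 2 ^ w) ->
      forall x, x < sp -> run_ops m os x < 2 ^ w].
Proof.
elim: os m T => [|[i c] os IHos] m T /=.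
  by move=> beh _; split; rewrite ?diffxx.
move=> beh valid; have [lti ltc] := valid _ (mem_head _ _).
have := beh (conj (ltP lti) (ltP ltc)); rewrite {beh}.
rewrite /run_op /=; case E: run => [[[m' a] cost]|] // [/leP le_cost [_ beh]].
have [|beh' diff' bnd'] := IHos _ _ beh.
  by move=> o os_o; rewrite size_subst_letter //; apply: valid; rewrite inE os_o orbT.
split=> //.
  rewrite mulnS; apply: leq_trans (diff_trans _ _ m' _) (leq_add _ diff').
  exact: leq_trans (run_diff E) le_cost.
by move=> bnd; apply/bnd'/(run_bounded E).
Qed.

Variables B' R' : nat.
Local Notation B := B'.+1.
Local Notation R := R'.+1.
Local Notation N := (B ^ R.+1).

Hypothesis correct : lcs_ds_correct DS n n sp w t.
Hypothesis leaf_fits : N * (2 * R).+1 <= n.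
Hypothesis vertex_fits : R * N * R.+2 <= n.
Hypothesis letters_fit : 5 + R * N <= n.

Local Notation elt := ('I_R * 'I_N)%type.
Implicit Types (D : {set elt}) (e : elt).

Definition elt_mem D (i s : nat) := [exists e : elt in D, (e.1 == i :> nat) && (e.2 == s :> nat)].

(** For [e] of level [i], the low [i + 1] digits name a tree vertex; the rest, a multiple of
    [B ^ i.+1], is the time at which its mark is written. *)
Definition slot e := e.2 %% B ^ e.1.+1.

Definition elt_op D e : nat * nat :=
  (vertex_pos R N e.1 (slot e), if e \in D then 1 else 2).

(* The vertices whose mark is rewritten at time [y]. *)
Definition due y : seq elt := [seq e : elt <- enum {: elt} | e.2 - slot e == y].

Definition block D y := map (elt_op D) (due y).

Definition set_mark D (mu : nat -> nat -> bool) e (i u : nat) :=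
  if (i == e.1 :> nat) && (u == slot e) then e \in D else mu i u.

Definition no_mark (i u : nat) := false.

(** State [y] precedes the updates of time [y]; a query of time [y] is asked in state [y.+1]. *)
Fixpoint marks D y :=
  if y is y'.+1 then foldl (set_mark D) (marks D y') (due y') else no_mark.

Definition init := ds_init DS (leaf_string B R N) (vertex_string B R N no_mark).

Fixpoint snapshot D y :=
  if y is y'.+1 then run_ops (snapshot D y') (block D y') else init.

Lemma slot_lt e : slot e < N.
Proof. exact: leq_ltn_trans (leq_mod _ _) (ltn_ord _). Qed.

Lemma subst_elts D es mu :
  subst_ops (vertex_string B R N mu) (map (elt_op D) es) =
  vertex_string B R N (foldl (set_mark D) mu es).
Proof.
elim: es mu => //= e es IHes mu.
by rewrite (@subst_vertex B R N (N_gt0 B' R') mu (set_mark D mu e)) ?slot_lt.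
Qed.

Lemma foldl_set_mark D es mu i u b :
  {in es, forall e, e.1 = i :> nat -> slot e = u -> (e \in D) = b} ->
  foldl (set_mark D) mu es i u =
  if has (fun e => (e.1 == i :> nat) && (slot e == u)) es then b else mu i u.
Proof.
elim/last_ind: es => //= es e IHes Db.
rewrite -cats1 foldl_cat /= has_cat /= orbF /set_mark eq_sym [u == _]eq_sym.
case: andP => [[/eqP Ei /eqP Eu] | _].
  by rewrite orbT Db // mem_rcons mem_head.
rewrite orbF IHes // => e' es_e'; apply: Db.
by rewrite mem_rcons inE es_e' orbT.
Qed.

(** Level [i] is rewritten only at multiples of [B ^ i.+1], and then completely, so the mark in
    force stems from the last multiple up to [y]. This agrees with [elem]. *)
Lemma marksE D y i u : y < N -> i < R ->
  marks D y.+1 i u = (u < B ^ i.+1) && elt_mem D i (u + B ^ i.+1 * (y %/ B ^ i.+1)).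
Proof.
move=> lty lti; set P := B ^ i.+1; have P_gt0: 0 < P by rewrite expn_gt0.
have dvPN: P %| N by rewrite dvdn_exp2l // ltnW.
have slotE e : e.1 = i :> nat -> slot e = e.2 %% P by rewrite /slot /P => ->.
have mem_due e y' : (e \in due y') = (e.2 - slot e == y').
  by rewrite mem_filter mem_enum inE andbT.
have skip y' : ~~ ((P %| y') && (u < P)) -> y' < N ->
    marks D y'.+1 i u = marks D y' i u.
  move=> skip lty'; rewrite /= (@foldl_set_mark D _ _ i u false); last first.
    move=> e; rewrite mem_due => /eqP Ey Ei Eu; case/negP: skip.
    rewrite -Ey -Eu slotE // ltn_mod P_gt0 andbT.
    by rewrite {1}(divn_eq e.2 P) addnK dvdn_mull.
  rewrite ifF //; apply/negbTE/hasPn => e; rewrite mem_due => /eqP Ey.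
  apply: contra skip => /andP[/eqP Ei /eqP Eu].
  rewrite -Ey -Eu slotE // ltn_mod P_gt0 andbT.
  by rewrite {1}(divn_eq e.2 P) addnK dvdn_mull.
have [ltu | leu] := ltnP u P; last first.
  have all_skip y' : y' <= N -> marks D y' i u = false.
    elim: y' => // y' IHy lty'; rewrite skip ?IHy //; first exact: ltnW.
    by rewrite negb_and -leqNgt leu orbT.
  exact: (all_skip y.+1).
have hit y' : P %| y' -> y' < N -> marks D y'.+1 i u = elt_mem D i (u + y').
  move=> dvy lty'; have ltuy: u + y' < N.
    have [k Ek] := dvdnP dvPN; have [k' Ek'] := dvdnP dvy.
    have ltk: k' < k by rewrite -(ltn_pmul2r P_gt0) -Ek -Ek'.
    rewrite Ek Ek'; apply: leq_trans (_ : k'.+1 * P <= _).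
      by rewrite mulSn ltn_add2r.
    by rewrite leq_mul2r ltk orbT.
  pose e0 : elt := (Ordinal lti, Ordinal ltuy).
  have slot0 : slot e0 = u.
    by rewrite slotE //= -modnDmr (eqP dvy) addn0 modn_small.
  rewrite /= (@foldl_set_mark D _ _ i u (e0 \in D)); last first.
    move=> e; rewrite mem_due => /eqP Ey Ei Eu; congr (_ \in D).
    case: e Ey Ei Eu => [i' s] /= Ey Ei Eu; congr (_, _); apply: val_inj => //=.
    by rewrite -Ey Eu addnC subnK // -Eu leq_mod.
  rewrite ifT; last first.
    by apply/hasP; exists e0; rewrite ?mem_due slot0 ?addKn ?eqxx.
  apply/idP/exists_inP => [De0 | [e De /andP[/eqP Ei /eqP Es]]].
    by exists e0; rewrite ?eqxx.
  by rewrite (_ : e0 = e) //; case: e Ei Es {De} => i' s /= Ei Es;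
     congr (_, _); apply: val_inj.
elim: y lty => [|y IHy] lty; first by rewrite hit ?dvdn0 // div0n muln0.
have [dvy | ndvy] := boolP (P %| y.+1).
  by rewrite hit // [P * _]mulnC divnK.
rewrite skip ?(negbTE ndvy) // IHy ?(ltnW lty) //.
by rewrite divnS // (negbTE ndvy).
Qed.

Lemma vertex_string_ops y D :
  subst_ops (vertex_string B R N no_mark) (flatten [seq block D y' | y' <- iota 0 y])
  = vertex_string B R N (marks D y).
Proof.
elim: y => // y IHy; rewrite -[y.+1]addn1 iotaD map_cat flatten_cat /= cats0 add0n.
by rewrite /subst_ops foldl_cat -/subst_ops IHy subst_elts addn1.
Qed.

Lemma snapshot_ops y D :
  run_ops init (flatten [seq block D y' | y' <- iota 0 y]) = snapshot D y.
Proof.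
elim: y => // y IHy; rewrite -[y.+1]addn1 iotaD map_cat flatten_cat /= cats0 add0n.
by rewrite /run_ops foldl_cat -/run_ops IHy addn1.
Qed.

Lemma block_valid D y : {in block D y, forall o, o.1 < R * N * R.+2 /\ o.2 < n}.
Proof.
move=> _ /mapP[e _ ->] /=; split; first by apply: vertex_pos_lt; rewrite ?slot_lt ?ltn_ord ?expn_gt0.
have NR0: 0 < R * N by rewrite muln_gt0 expn_gt0.
by case: ifP => _; lia.
Qed.

Lemma letters_ltP sigma s : {in s, forall x, x < sigma} -> letters_lt sigma s.
Proof.
move=> lt_s x s_x; apply/ltP/lt_s; elim: s s_x {lt_s} => //= y s IHs.
by case=> [-> | /IHs]; rewrite inE ?eqxx // => ->; rewrite orbT.
Qed.

Lemma correct_init :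
  (forall x, x < sp -> init x < 2 ^ w) /\
  forall ops, behaves DS n sp w t init
                (leaf_string B R N) (vertex_string B R N no_mark) ops.
Proof.
have [||||bnd beh] := correct (S := leaf_string B R N)
  (T := vertex_string B R N no_mark).
- by apply/leP; rewrite length_size size_mkseq.
- by apply/leP; rewrite length_size size_mkseq.
- apply: letters_ltP => x /mapP[p]; rewrite mem_iota => /andP[_ ltp] ->.
  exact: leq_trans (leaf_letter_lt _ (N_gt0 B' R') ltp) letters_fit.
- apply: letters_ltP => x /mapP[p]; rewrite mem_iota => /andP[_ ltp] ->.
  exact: leq_trans (vertex_letter_lt _ (N_gt0 B' R') _ ltp) letters_fit.
by split=> // x /ltP/bnd/ltP; rewrite powE.
Qed.

Lemma snapshot_facts D y rest :
  [/\ behaves DS n sp w t (snapshot D y) (leaf_string B R N)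
        (vertex_string B R N (marks D y)) rest,
      diff sp (snapshot D y) (snapshot D y.+1) <= t * size (block D y) &
      forall x, x < sp -> snapshot D y x < 2 ^ w].
Proof.
have [bnd beh] := correct_init.
pose os := flatten [seq block D y' | y' <- iota 0 y].
have os_valid : {in os, forall o, o.1 < size (vertex_string B R N no_mark) /\ o.2 < n}.
  move=> o /flattenP[_ /mapP[y' _ ->]]; rewrite size_mkseq; exact: block_valid.
have [beh_rest _ bnd'] := behaves_ops (beh (_ ++ rest)) os_valid.
have [beh_block _ _] := behaves_ops (beh (_ ++ ([seq (true, o.1, o.2) | o <- block D y] ++ [::]))) os_valid.
rewrite vertex_string_ops snapshot_ops in beh_rest beh_block.
rewrite snapshot_ops in bnd'.
split=> //; last exact: bnd'.
have [|_ diff_y _] := behaves_ops beh_block; last exact: diff_y.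
by move=> o; rewrite size_mkseq; apply: block_valid.
Qed.

Lemma size_blocks D : \sum_(0 <= y < N) size (block D y) <= R * N.
Proof.
under eq_bigr => y _ do rewrite size_map size_filter -sum1_count.
rewrite (exchange_big_dep predT) //= -[R * N]muln1.
have -> : R * N * 1 = \sum_(e <- enum {: elt}) 1.
  by rewrite sum1_size -cardE card_prod !card_ord muln1.
apply: leq_sum => e _; rewrite big_mkord.
have lt_due: e.2 - slot e < N := leq_ltn_trans (leq_subr _ _) (ltn_ord _).
rewrite (bigD1 (Ordinal lt_due)) //= big1 // => y /andP[/eqP Ey].
by rewrite -val_eqE /= Ey eqxx.
Qed.

Lemma breaks_snapshots D :
  breaks (history N (snapshot D)) (sp * N.+1) <= 2 * (t * (R * N)).
Proof.
apply: leq_trans (breaks_history _ _ _) _; rewrite leq_mul2l /=.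
apply: leq_trans (_ : \sum_(0 <= y < N) t * size (block D y) <= _).
  by apply: leq_sum => y _; have [] := snapshot_facts D y [::].
by rewrite -big_distrr leq_mul2l size_blocks orbT.
Qed.

(** The activation runs from a snapshot and its memory is discarded, so queries do not affect each
    other. *)
Definition query_prog (q : 'I_N * 'I_N) := ds_upd DS false (leaf_pos R q.1) 1.

Lemma query_correct D (q : 'I_N * 'I_N) : exists m' i j l c,
  [/\ run sp w (snapshot D q.2.+1) (query_prog q) = Some (m', (i, j, l), c),
      c <= t & [disjoint els q & D] = (l <= R)].
Proof.
have [beh _ _] := snapshot_facts D q.2.+1 [:: (false, leaf_pos R q.1, 1)].
have valid : leaf_pos R q.1 < size (leaf_string B R N) /\ 1 < n.
  rewrite size_mkseq leaf_pos_lt ?expn_gt0 //; split=> //.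
  exact: leq_trans letters_fit.
have := beh (conj (ltP valid.1) (ltP valid.2)).
rewrite -/(query_prog q); case: run => [[[m' [[i j] l]] c]|] // [/leP le_c [lcs _]].
exists m', i, j, l, c; split=> //; rewrite leqNgt.
rewrite (lcs_gadget (N_gt0 B' R') (ltn_ord q.1) (erefl _) _ lcs); last first.
  by move=> i' u lti'; rewrite marksE // => /andP[].
rewrite disjoint_subset; apply/subsetP/existsPn => [dis d | free e].
  rewrite marksE //; apply/negP=> /andP[_ /exists_inP[e De /andP[/eqP Ed /eqP Es]]].
  have /dis: e \in els q by rewrite inE /elem Es Ed.
  by rewrite inE De.
rewrite !inE => /eqP Es; apply/negP => De; case/negP: (free e.1).
rewrite marksE // ltn_mod expn_gt0; apply/exists_inP.
by exists e => //; rewrite Es !eqxx.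
Qed.

Definition keys_read D (q : 'I_N * 'I_N) :=
  [seq cell_key N a q.2.+1 | a <- reads (snapshot D q.2.+1) (query_prog q)].

Theorem update_time_obstruction (h kappa : nat)
  (M := R * B ^ R) (P := (2 * (t * (R * N))).+1) (K := sp * N.+1) :
  B ^ R * t <= kappa <= P ->
  2 ^ M.+1 * ('C(P, kappa) * h ^ M) < B`! ^ (R * B ^ R') ->
  2 ^ M.+1 * (K.+1 * K.+1 * (2 ^ w).+2) ^ kappa < 2 ^ (M * h) ->
  False.
Proof.
move=> /andP[le_kappa kappa_le] batches_many certs_few.
have := (@no_certificates _ _ _ (@els B' R') (@qs B' R') M h kappa K P (2 ^ w).+1 t
          (fun D => history N (snapshot D)) keys_read); apply => //.
- exact: card_touched.
- by move=> A; apply: leq_trans le_kappa; rewrite leq_mul2r card_qs orbT.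
- by move=> V; apply: (@spread B' R' V h).
(* The values are 0 and [v.+1] with [v < 2 ^ w], hence the bound [(2 ^ w).+1]. *)
- move=> D k ltk; rewrite /history; case: ifP => // _; rewrite ltnS.
  have [_ _] := snapshot_facts D (k %% N.+1) [::]; apply.
  by rewrite ltn_divLR.
- by move=> D; rewrite ltnS breaks_snapshots.
- move=> D q _ /mapP[a a_r ->]; have [m' [i [j [l [c [E _ _]]]]]] := query_correct D q.
  have [_ /(_ _ a_r) lta] := run_reads E.
  rewrite /cell_key /K; apply: leq_trans (_ : a.+1 * N.+1 <= _).
    by rewrite mulSn addnC ltn_add2r ltnS.
  by rewrite leq_mul2r lta orbT.
- move=> D q; rewrite size_map; have [m' [i [j [l [c [E lec _]]]]]] := query_correct D q.
  by have [le_r _] := run_reads E; apply: leq_trans le_r lec.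
- move=> D D' q eq_hist; have [m' [i [j [l [c [E _ ->]]]]]] := query_correct D q.
  have [m1 [i1 [j1 [l1 [c1 [E1 _ ->]]]]]] := query_correct D' q.
  (* All mark sets share the initial memory [init], so equal histories mean equal cell contents. *)
  have [|m2 E2] := run_local E (m2 := snapshot D' q.2.+1).
    move=> a a_r; have := eq_hist _ (map_f _ a_r); rewrite !historyE //=.
    by do 2![case: eqP => [->|_] //]; case.
  by move: E1; rewrite E2 => -[_ _ _ ->].
- by rewrite card_ffun card_prod !card_ord card_Sn.
Qed.

End Timeline.

(** * Parameters *)

Lemma behaves_weaken DS sigma sp w t t' m S T ops : t <= t' ->
  behaves DS sigma sp w t m S T ops -> behaves DS sigma sp w t' m S T ops.
Proof.
move=> let'; elim: ops m S T => //= -[[j i] c] ops IHops m S T beh /beh.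
case: run => [[[m' a] cost]|] // [le_c [lcs rest]].
by split; [lia | split=> //; apply: IHops].
Qed.

Lemma bin_leq_exp2 n k : 'C(n, k) <= 2 ^ n.
Proof.
rewrite -[n in leqLHS]card_ord -card_draws -[n in leqRHS]card_ord -cardsT.
by rewrite -card_powerset powersetT; apply/subset_leq_card/subsetT.
Qed.

(** [n ^ n] is at most [(2n)! / n! = 'C(2n, n) * n!], and the binomial is at most [2 ^ (2n)]. *)
Lemma expnn_fact n : n ^ n <= 4 ^ n * n`!.
Proof.
have le_ffact : n ^ n <= (n + n) ^_ n.
  rewrite ffact_prod -[X in _ ^ X]card_ord -prod_nat_const.
  by apply: leq_prod => i _; have := ltn_ord i; lia.
apply: leq_trans le_ffact _; rewrite -bin_ffact leq_mul2r; apply/orP; right.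
by rewrite -[4]/(2 ^ 2) -expnM mul2n -addnn bin_leq_exp2.
Qed.

Lemma bin_leq_exp P a k : 0 < k -> P <= a * k -> 'C(P, k) <= (4 * a) ^ k.
Proof.
move=> k_gt0 leP; rewrite -(@leq_pmul2r (k ^ k)) ?expn_gt0 ?k_gt0 //.
apply: leq_trans (leq_mul (leqnn _) (expnn_fact k)) _.
rewrite mulnCA bin_ffact -expnMn -mulnA expnMn leq_mul2l; apply/orP; right.
apply: leq_trans (_ : P ^ k <= _); last by rewrite leq_exp2r.
rewrite ffact_prod -[X in _ ^ X]card_ord -prod_nat_const.
by apply: leq_prod => i _; apply: leq_subr.
Qed.

(** With [R = 4 * rho] and [kappa = rho * B ^ R] one has [M = 4 * kappa]. The last two hypotheses
    are [kappa]-th roots of the counting conditions, after bounding [B!] below by [(B / 4) ^ B]. *)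
Theorem update_time_gt DS n sp w t B rho h :
  0 < B -> 0 < rho ->
  lcs_ds_correct DS n n sp w t ->
  B ^ (4 * rho).+1 * (2 * (4 * rho)).+1 <= n ->
  4 * rho * B ^ (4 * rho).+1 * (4 * rho).+2 <= n ->
  5 + 4 * rho * B ^ (4 * rho).+1 <= n ->
  2 ^ 13 * 36 * rho * h ^ 4 < B ^ 3 ->
  32 * ((sp * (B ^ (4 * rho).+1).+1).+1 ^ 2 * (2 ^ w).+2) < 2 ^ (4 * h) ->
  rho < t.
Proof.
case: B => // B' _ rho_gt0 correct fit1 fit2 fit3 large_B large_h.
rewrite ltnNge; apply/negP => le_t.
have correct' : lcs_ds_correct DS n n sp w rho.
  move=> S T leS leT lS lT; have [bnd beh] := correct S T leS leT lS lT.
  by split=> // ops; apply: behaves_weaken le_t (beh ops).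
set B := B'.+1 in fit1 fit2 fit3 large_B large_h.
have B_gt0: 0 < B by [].
case ER: (4 * rho) fit1 fit2 fit3 large_h => [|R'] fit1 fit2 fit3 large_h; first by lia.
pose kappa := B ^ R'.+1 * rho.
have kappa_gt0: 0 < kappa by rewrite muln_gt0 expn_gt0.
have EM: R'.+1 * B ^ R'.+1 = 4 * kappa by rewrite /kappa -ER; move: (B ^ _) => X; lia.
have EP: 2 * (rho * (R'.+1 * B ^ R'.+2)) = 8 * rho * B * kappa.
  by rewrite expnS /kappa -ER; move: (B ^ _) => X; lia.
have le_kB: kappa <= rho * B * kappa by rewrite leq_pmull // muln_gt0 rho_gt0.
apply: (@update_time_obstruction DS n sp w rho B' R' correct' fit1 fit2 fit3 h kappa).
- by rewrite leqnn EP; lia.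
- rewrite EM EP -/B.
  (* The number of pieces is at most [9 * rho * B * kappa], one ninth of it absorbing the successor;
     36 is [4 * 9]. *)
  have le_bin: 'C((8 * rho * B * kappa).+1, kappa) <= (36 * rho * B) ^ kappa.
    by rewrite (_ : 36 * rho * B = 4 * (9 * rho * B)) ?bin_leq_exp //; lia.
  have le_fact: B ^ (4 * kappa) <= 4 ^ (4 * kappa) * B`! ^ (R'.+1 * B ^ R').
    have -> : 4 * kappa = B * (R'.+1 * B ^ R') by rewrite -EM expnS; lia.
    rewrite 2!(expnM _ B) -expnMn leq_exp2r ?expnn_fact // muln_gt0 expn_gt0 //.
  rewrite -(@ltn_pmul2l (4 ^ (4 * kappa))) ?expn_gt0 //.
  apply: leq_trans le_fact.
  apply: leq_ltn_trans (_ : (2 ^ 13 * 36 * rho * h ^ 4 * B) ^ kappa < _); last first.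
    by rewrite expnM ltn_exp2r // (expnSr B 3) ltn_pmul2r.
  have -> : 2 ^ 13 * 36 * rho * h ^ 4 * B = 4 ^ 4 * (2 ^ 4 * 2 * (36 * rho * B * h ^ 4)).
    by lia.
  rewrite expnMn -expnM leq_mul2l; apply/orP; right.
  have -> : (2 ^ 4 * 2 * (36 * rho * B * h ^ 4)) ^ kappa =
      2 ^ (4 * kappa) * 2 ^ kappa * ((36 * rho * B) ^ kappa * h ^ (4 * kappa)).
    by rewrite [2 ^ (4 * _)]expnM [h ^ (4 * _)]expnM -!expnMn.
  rewrite expnSr; apply: leq_mul; apply: leq_mul => //.
  by rewrite -[leqLHS]expn1 leq_exp2l.
- rewrite EM; apply: leq_ltn_trans (_ : (32 * ((sp * (B ^ R'.+2).+1).+1 ^ 2 * (2 ^ w).+2)) ^ kappa < _).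
    rewrite [leqRHS]expnMn; apply: leq_mul; last by rewrite -mulnn.
    rewrite -[32]/(2 ^ 5) -expnM leq_exp2l //; lia.
  by rewrite [4 * kappa * h]mulnAC expnM ltn_exp2r.
Qed.

Lemma leq_exp2_linear m : 9 <= m -> 32 * m.+1 <= 2 ^ m.
Proof.
elim: m => // m IHm; rewrite leq_eqVlt => /predU1P[<- // | lt9m].
by have := IHm lt9m; rewrite expnS; lia.
Qed.

(** [L] and [m] are the rounded binary logarithms of [n] and [L]. The choices are
    [B = 2 ^ (2 * m.+1)], at least [L.+1 ^ 2], with [rho] of order [L / m] and [h] of order [L]. *)
Theorem lcs_update_time k c : exists L0, forall L n sp w t DS,
  L0 <= L -> 2 ^ L <= n < 2 ^ L.+1 -> sp <= n ^ k -> w <= c * L.+1 ->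
  lcs_ds_correct DS n n sp w t ->
  exists m, 2 ^ m <= L /\ L <= 32 * m.+1 * t.
Proof.
(* With [h = a * L.+1], the exponent [4 * h] exceeds the bits of two keys, a cell content and the
   factor 32. *)
pose a := k + c + 4.
(* 512 forces [m >= 9] and thus [rho > 0]; the other term absorbs the constants in the comparison
   with [B ^ 3]. *)
exists (512 + 2 ^ 13 * 36 * a ^ 4) => L n sp w t DS leL0 /andP[len ltn] le_sp le_w correct.
have L512 : 512 <= L by apply: leq_trans leL0; apply: leq_addr.
have La : 2 ^ 13 * 36 * a ^ 4 <= L by apply: leq_trans leL0; apply: leq_addl.
pose m := trunc_log 2 L.
have L_gt0: 0 < L by lia.
have le_m : 2 ^ m <= L by apply: trunc_logP.
have lt_m : L < 2 ^ m.+1 by apply: trunc_log_ltn.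
have m9 : 9 <= m by rewrite -ltnS -(@ltn_exp2l 2) //; apply: leq_ltn_trans lt_m.
have lin : 32 * m.+1 <= L := leq_trans (leq_exp2_linear m9) le_m.
exists m; split=> //.
pose rho := L %/ (32 * m.+1); pose B := 2 ^ (2 * m.+1).
have m_gt0: 0 < 32 * m.+1 by [].
have rho_gt0 : 0 < rho by rewrite divn_gt0.
have rho_le : 32 * m.+1 * rho <= L by rewrite mulnC leq_divM.
have rho_leL : rho <= L by apply: leq_div.
suff: rho < t.
  rewrite -ltnS in rho_leL *; move=> lt_rho.
  have := ltn_ceil L m_gt0; rewrite -/rho => /ltnW lt_L; apply: leq_trans lt_L _.
  by rewrite mulnC leq_mul2l lt_rho orbT.
have B_gt0 : 0 < B by rewrite expn_gt0.
have BL : L.+1 ^ 2 <= B by rewrite /B mulnC expnM leq_exp2r.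
(* The spare factor [B ^ 2 >= L.+1 ^ 4] pays for block lengths and levels. *)
have NB : B ^ (4 * rho).+1 * B ^ 2 <= n.
  apply: leq_trans len; rewrite /B -!expnM -expnD leq_exp2l //; nia.
have R_le : 4 * rho <= L by nia.
have B2 : L.+1 ^ 4 <= B ^ 2 by rewrite (expnM _ 2 2) leq_exp2r.
have NgtL x : x <= L.+1 ^ 4 -> B ^ (4 * rho).+1 * x <= n.
  move=> le_x; apply: leq_trans NB; rewrite leq_mul2l; apply/orP; right.
  exact: leq_trans le_x B2.
have L4 : 6 * L * L <= L.+1 ^ 4 by rewrite !expnS; nia.
apply: (@update_time_gt DS n sp w t B rho (a * L.+1)) => //.
- by apply: NgtL; nia.
- by rewrite [4 * rho * _]mulnC -mulnA; apply: NgtL; nia.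
- apply: leq_trans (NgtL (5 + 4 * rho) _); last by nia.
  rewrite mulnDr [_ * (4 * rho)]mulnC leq_add2r -[leqLHS]mul1n leq_mul2r.
  by rewrite expn_gt0 B_gt0.
- apply: leq_trans (_ : L.+1 ^ 6 <= _); last by rewrite (expnM _ 2 3) leq_exp2r.
  rewrite expnMn; apply: leq_ltn_trans (_ : L * L.+1 ^ 5 < _).
    have -> : 2 ^ 13 * 36 * rho * (a ^ 4 * L.+1 ^ 4) =
        2 ^ 13 * 36 * a ^ 4 * (rho * L.+1 ^ 4).
      by move: (2 ^ 13 * 36) (a ^ 4) (L.+1 ^ 4) => x y z; lia.
    by apply: leq_mul => //; rewrite (expnS _ 4) leq_mul // ltnW.
  by rewrite [ltnRHS]expnS ltn_pmul2r ?expn_gt0.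
- set N := B ^ _; have ltN : N.+1 <= 2 ^ L.+1.
    apply: leq_ltn_trans ltn; rewrite -[N]muln1; apply: NgtL.
    by rewrite expn_gt0.
  have le_sp2 : sp <= 2 ^ (L.+1 * k).
    apply: leq_trans le_sp _; rewrite expnM; case: (k) => // k'.
    by rewrite leq_exp2r // ltnW.
  have le1 : (sp * N.+1).+1 <= 2 ^ (L.+1 * k + L.+1).+1.
    apply: leq_trans (_ : (2 ^ (L.+1 * k + L.+1)).+1 <= _).
      by rewrite ltnS expnD leq_mul.
    by rewrite expnS mul2n -addnn -add1n leq_add2r expn_gt0.
  have le2 : (2 ^ w).+2 <= 2 ^ w.+2.
    have : 0 < 2 ^ w by rewrite expn_gt0.
    by rewrite !expnS; clear; lia.
  apply: leq_ltn_trans (_ : 2 ^ 5 * ((2 ^ (L.+1 * k + L.+1).+1) ^ 2 * 2 ^ w.+2) < _).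
    by rewrite leq_mul2l leq_mul ?leq_exp2r.
  rewrite -expnM -!expnD ltn_exp2l // /a; move: L512 le_w; clear.
  by rewrite !mulnDl mulnDr -[L.+1 * k]mulnC; lia.
Qed.

Corollary lcs_update_time_Peano k c : exists L0, forall L n sp w t DS,
  (L0 <= L)%coq_nat -> (Nat.pow 2 L <= n)%coq_nat -> (n < Nat.pow 2 (S L))%coq_nat ->
  (sp <= Nat.pow n k)%coq_nat -> (w <= c * S L)%coq_nat ->
  lcs_ds_correct DS n n sp w t ->
  exists m, (Nat.pow 2 m <= L)%coq_nat /\ (L <= 32 * S m * t)%coq_nat.
Proof.
have [L0 main] := lcs_update_time k c; exists L0 => L n sp w t DS.
rewrite !powE => /leP leL0 /leP len /ltP ltn /leP le_sp /leP le_w correct.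
have [|m [le_m le_L]] := main L n sp w t DS leL0 _ le_sp le_w correct.
  by rewrite len.
by exists m; rewrite powE; split; apply/leP.
Qed.

End MarkedAncestors.

(** * From powers of two to natural logarithms *)

Open Scope R_scope.

Lemma ln_le (x y : R) : 0 < x -> x <= y -> ln x <= ln y.
Proof.
  intros Hx [Hxy | ->]; [left; now apply ln_increasing | right; reflexivity].
Qed.

Lemma ln_2_bounds : 1 / 2 <= ln 2 <= 1.
Proof.
  split.
  - pose proof ln_lt_2; lra.
  - rewrite <- (ln_exp 1). apply ln_le; [lra | pose proof (exp_ineq1 1); lra].
Qed.

Lemma ln_pow2 (L : nat) : ln (INR (2 ^ L)) = INR L * ln 2.
Proof. rewrite pow_INR. change (INR 2) with 2. apply ln_pow; lra. Qed.

Lemma INR_pow2_pos (L : nat) : 0 < INR (2 ^ L).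
Proof. apply lt_0_INR. pose proof (Nat.pow_nonzero 2 L); lia. Qed.

Lemma ln_between_pow2 (L n : nat) :
  (2 ^ L <= n)%nat -> (n < 2 ^ S L)%nat ->
  INR L * ln 2 <= ln (INR n) <= (INR L + 1) * ln 2.
Proof.
  intros Hlo Hhi. pose proof (INR_pow2_pos L).
  split.
  - rewrite <- ln_pow2. apply ln_le; [assumption | apply le_INR; lia].
  - rewrite <- S_INR, <- ln_pow2. apply ln_le; [|apply le_INR; lia].
    apply Rlt_le_trans with (INR (2 ^ L)); [assumption | apply le_INR; lia].
Qed.

(** With [x = ln n] and [y = ln x], one has [x <= 2 * L] and [m + 1 <= 3 + 2 * y <= 5 * y], so the
    constant is [320 = 2 * 32 * 5]. *)
Lemma tradeoff_real (L m n t : nat) :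
  (16 <= L)%nat -> (2 ^ L <= n)%nat -> (n < 2 ^ S L)%nat ->
  (2 ^ m <= L)%nat -> (L <= 32 * S m * t)%nat ->
  1 / 320 * (ln (INR n) / ln (ln (INR n))) <= INR t.
Proof.
  intros HL Hlo Hhi Hm Ht.
  pose proof ln_2_bounds as [Hln2 Hln2'].
  destruct (ln_between_pow2 L n Hlo Hhi) as [Hn Hn'].
  assert (HL' : 16 <= INR L) by (replace 16 with (INR 16) by (simpl; lra); apply le_INR; lia).
  set (x := ln (INR n)) in *.
  assert (HLx : INR L <= 2 * x) by nra.
  assert (Hx : x <= 2 * INR L) by nra.
  assert (Hx8 : 8 <= x) by lra.
  set (y := ln x).
  assert (Hy : 1 <= y).
  { unfold y. rewrite <- (ln_exp 1). apply ln_le; [apply exp_pos|].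
    pose proof exp_le_3; lra. }
  assert (Hmy : INR m <= 2 + 2 * y).
  { assert (INR m * ln 2 <= ln 2 + y).
    { rewrite <- ln_pow2. unfold y. rewrite <- ln_mult by lra.
      apply ln_le; [apply INR_pow2_pos|].
      apply Rle_trans with (INR L); [apply le_INR; exact Hm | exact HLx]. }
    pose proof (pos_INR m). nra. }
  assert (HT : INR L <= 32 * (INR m + 1) * INR t).
  { apply le_INR in Ht. rewrite !mult_INR, (S_INR m) in Ht.
    replace (INR 32) with 32 in Ht by (simpl; lra). exact Ht. }
  pose proof (pos_INR t) as Ht0.
  assert (Hm5 : (INR m + 1) * INR t <= 5 * y * INR t)
    by (apply Rmult_le_compat_r; lra).
  assert (Hfin : x <= 320 * (y * INR t)) by lra.
  apply Rmult_le_reg_l with y; [lra|].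
  replace (y * (1 / 320 * (x / y))) with (x / 320) by (field; lra).
  lra.
Qed.

(* For every family of data structures D n (strings of length <= n over the
   integer alphabet {0,..,n-1}) with word size w n = Theta(log n), space
   s n <= n^k cells, and worst-case update time t n, we have
   t n = Omega(log n / log log n). *)
Theorem theorem32 :
  forall (w s t : nat -> nat) (D : nat -> lcs_ds),
    (exists c1 c2 : R, 0 < c1 /\ 0 < c2 /\ exists N : nat, forall n : nat,
        (N <= n)%nat -> c1 * ln (INR n) <= INR (w n) <= c2 * ln (INR n)) ->
    (exists (k N : nat), forall n : nat, (N <= n)%nat -> (s n <= n ^ k)%nat) ->
    (forall n : nat, lcs_ds_correct (D n) n n (s n) (w n) (t n)) ->
    exists c : R, 0 < c /\ exists N : nat, forall n : nat, (N <= n)%nat ->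
      c * (ln (INR n) / ln (ln (INR n))) <= INR (t n).
Proof.
  intros w s t D (c1 & c2 & Hc1 & Hc2 & N1 & Hw) (k & N2 & Hs) Hcor.
  destruct (INR_unbounded c2) as [c Hc].
  destruct (MarkedAncestors.lcs_update_time_Peano k c) as [L0 HL0].
  exists (1 / 320). split; [lra|].
  exists (Nat.max (Nat.max N1 N2) (2 ^ Nat.max L0 16)). intros n Hn.
  assert (Hpow : (2 ^ Nat.max L0 16 <= n)%nat) by lia.
  assert (Hpos : (0 < n)%nat) by (pose proof (Nat.pow_nonzero 2 (Nat.max L0 16)); lia).
  set (L := Nat.log2 n).
  destruct (Nat.log2_spec n Hpos) as [Hlo Hhi]. fold L in Hlo, Hhi.
  assert (HL : (Nat.max L0 16 <= L)%nat).
  { unfold L. rewrite <- (Nat.log2_pow2 (Nat.max L0 16)) by lia.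
    apply Nat.log2_le_mono; exact Hpow. }
  (* As [ln 2 <= 1], [ln n <= L + 1], so an integer [c] above [c2] serves for binary logarithms. *)
  assert (Hwn : (w n <= c * S L)%nat).
  { apply INR_le. rewrite mult_INR, S_INR.
    destruct (Hw n ltac:(lia)) as [_ Hup].
    pose proof ln_2_bounds. destruct (ln_between_pow2 L n Hlo Hhi) as [Hn1 Hn2].
    pose proof (pos_INR L).
    assert (0 <= ln (INR n)) by nra.
    assert (ln (INR n) <= INR L + 1) by nra.
    nra. }
  destruct (HL0 L n (s n) (w n) (t n) (D n)) as (m & Hm & Ht);
    [lia | exact Hlo | exact Hhi | apply Hs; lia | exact Hwn | apply Hcor |].
  apply (tradeoff_real L m n); try assumption; lia.
Qed.
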